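(* If $(I_n)_{n\in\mathbb{N}}$ is a $\operatorname{Sym}$-invariant chain of squarefree monomial ideals $I_n\subseteq R_n$, then the number of $\operatorname{Sym}(n)$-orbits needed to generate the prime components of $I_n$ whose height equals the height of $I_n$ (i.e. the number of $\operatorname{Sym}(n)$-orbits of such prime components) grows polynomially in $n$ eventually; that is, it agrees with a polynomial in $n$ for all sufficiently large $n$.
   Context: $\mathbb{N}$ denotes the positive integers. Fix $c\in\mathbb{N}$ and a field $\mathbf{k}$. Let $R_n=\mathbf{k}[x_{i,j}\mid i\in[c],j\in[n]]$, with $R_m\subseteq R_n$ for $m\le n$ and $\operatorname{Sym}(n)$ acting by $\sigma\cdot x_{i,j}=x_{i,\sigma(j)}$. A $\operatorname{Sym}$-invariant chain is a sequence of ideals $I_n\subseteq R_n$ with $\sigma(f)\in I_n$ for all $m\le n$, $f\in I_m$, $\sigma\in\operatorname{Sym}(n)$. The prime components of a squarefree monomial ideal are its associated (equivalently minimal) primes; $\operatorname{Sym}(n)$ acts on those of $I_n$, preserving height. *)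

(* Defs.v *)
From HB Require Import structures.
From mathcomp Require Import all_boot all_order all_algebra all_fingroup.
From mathcomp Require Import mpoly.

Set Implicit Arguments.
Unset Strict Implicit.
Unset Printing Implicit Defensive.

Import GRing.Theory.
Local Open Scope ring_scope.

(* Ideals are Prop-valued predicates, so that no decidability of membership is
   assumed; two of them are identified when they have the same elements. The
   unit ideal is allowed as an ideal. *)
Section Ideals.
Variable R : comNzRingType.
Implicit Types (I J P G : R -> Prop).

Definition sub_ideal I J : Prop := forall f, I f -> J f.
Definition eq_ideal I J : Prop := forall f, I f <-> J f.

Definition is_ideal I : Prop :=
  [/\ I 0, forall f g, I f -> I g -> I (f + g) & forall a f, I f -> I (a * f)].

Definition ideal_gen G : R -> Prop :=
  fun f => forall J, is_ideal J -> (forall g, G g -> J g) -> J f.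

Definition is_prime P : Prop :=
  [/\ is_ideal P, ~ P 1 & forall f g, P (f * g) -> P f \/ P g].

(* P is a prime ideal of the form (I : f). *)
Definition associated_prime I P : Prop :=
  is_prime P /\ exists f, forall g, P g <-> I (f * g).

(* A chain of primes Q 0 < Q 1 < ... < Q h = P with h strict inclusions. *)
Definition prime_chain_to P (h : nat) (Q : nat -> R -> Prop) : Prop :=
  [/\ forall i, (i <= h)%N -> is_prime (Q i),
      forall i, (i < h)%N -> sub_ideal (Q i) (Q i.+1) /\ ~ sub_ideal (Q i.+1) (Q i)
    & eq_ideal (Q h) P].

Definition prime_height P (h : nat) : Prop :=
  (exists Q, prime_chain_to P h Q) /\
  (forall h' Q, prime_chain_to P h' Q -> (h' <= h)%N).

(* The height of an ideal is the least height of a prime containing it. It is a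
   relation: the unit ideal has no height, and a prime of infinite height never
   attains the minimum. *)
Definition ideal_height I (h : nat) : Prop :=
  (exists P, [/\ is_prime P, sub_ideal I P & prime_height P h]) /\
  (forall P h', is_prime P -> sub_ideal I P -> prime_height P h' -> (h <= h')%N).

End Ideals.

Section Chains.
Variables (c : nat) (k : fieldType).

Definition polyR (n : nat) := {mpoly k[c * n]}.

(* Indices are 0-based: i : 'I_c is the row and j : 'I_n the column. *)
Definition xvar n (i : 'I_c) (j : 'I_n) : polyR n := 'X_(mxvec_index i j).

(* The k-algebra morphism R_m -> R_n with x_{i,j} |-> x_{i, g j}. *)
Definition relabel m n (g : 'I_m -> 'I_n) (f : polyR m) : polyR n :=
  f \mPo [tuple mxvec (\matrix_(i < c, j < m) xvar i (g j)) 0 l | l < c * m].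

Lemma relabel_xvar m n (g : 'I_m -> 'I_n) (i : 'I_c) (j : 'I_m) :
  relabel g (xvar i j) = xvar i (g j).
Proof. by rewrite /relabel /xvar comp_mpolyXU -tnth_nth tnth_mktuple mxvecE mxE. Qed.

Definition incl m n (le_mn : (m <= n)%N) : polyR m -> polyR n :=
  relabel (widen_ord le_mn).

Definition sym_act n (s : 'S_n) : polyR n -> polyR n := relabel s.

Definition squarefree_monomial_ideal n (I : polyR n -> Prop) : Prop :=
  exists M : 'X_{1..c * n} -> Prop,
    (forall m, M m -> forall l, (m l <= 1)%N) /\
    eq_ideal I (ideal_gen (fun f : polyR n => exists2 m, M m & f = 'X_[m])).

(* Only the members with positive index count; [I 0] is a dummy value. *)
Definition Sym_invariant_chain (I : forall n, polyR n -> Prop) : Prop :=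
  (forall n, (0 < n)%N -> is_ideal (@I n)) /\
  (forall m n (le_mn : (m <= n)%N) (s : 'S_n) (f : polyR m),
     (0 < m)%N -> I m f -> I n (sym_act s (incl le_mn f))).

Definition sym_image n (s : 'S_n) (P : polyR n -> Prop) : polyR n -> Prop :=
  fun g => exists2 f, P f & g = sym_act s f.

Definition same_orbit n (P Q : polyR n -> Prop) : Prop :=
  exists s : 'S_n, eq_ideal Q (sym_image s P).

(* For a squarefree monomial ideal, the prime components are the associated
   primes. *)
Definition min_height_component n (I P : polyR n -> Prop) : Prop :=
  associated_prime I P /\ exists h, ideal_height I h /\ prime_height P h.

(* There are exactly r orbits: P is a system of representatives. *)
Definition num_min_height_orbits n (I : polyR n -> Prop) (r : nat) : Prop :=
  exists P : 'I_r -> polyR n -> Prop,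
    [/\ forall a, min_height_component I (P a),
        forall a b, same_orbit (P a) (P b) -> a = b
      & forall Q, min_height_component I Q -> exists a, same_orbit (P a) Q].

End Chains.

(* Main.v *)
Require Import Defs.
From HB Require Import structures.
From Stdlib Require Import Classical.
From mathcomp Require Import all_boot all_order all_algebra all_fingroup.
From mathcomp Require Import mpoly.
From mathcomp Require Import zify ring.

(* A minimal-height component of a squarefree monomial ideal is generated by the variables outside
   a set D of maximal cardinality with x^D not in the ideal. Cutting D into columns, the
   Sym(n)-orbit of D is the vector d in N^(2^c) counting how often each subset of [c] occurs as a
   column; d has coordinate sum n and #|D| is a linear weight of d. The vectors d with x^D in I_n,
   n = |d|, form an upset U of N^(2^c), whose complement is a finite disjoint union of pieces
   a + N^F by Dickson's lemma. On a piece the number of vectors with sum n and fixed defect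
   s n - weight (s the largest weight of a free direction) is eventually polynomial in n, and for
   large n the maximal weight corresponds to one constant defect. *)

Set Implicit Arguments.
Unset Strict Implicit.
Unset Printing Implicit Defensive.

Import GRing.Theory Num.Theory Order.TTheory.

(** The maximal weight in degree n moves with n, so its attainments are not a priori one fixed
    count. The defect cures this: it is bounded below on all pieces at once, and the number of
    vectors of a given defect, being eventually polynomial, is either eventually zero or eventually
    nonzero. The least defect whose count is not eventually zero is therefore the minimum for every
    large n. Heights are defined by chains of arbitrary primes, which monomials alone do not
    control. They enter through two facts. They exist, since contraction to one variable fewer gives
    the crude bound d -> 2d + 1 on chain lengths. And the height of a variable prime grows strictly
    with its number of variables; as a prime containing I also contains the prime generated by its
    variables, which again contains I, least height means fewest variables. *)

Lemma classic_least (P : nat -> Prop) :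
  (exists n, P n) -> exists2 n, P n & forall m, (m < n)%N -> ~ P m.
Proof.
move=> [n]; elim/ltn_ind: n => n IH Pn.
have [[m lt_mn Pm]|noP] := classic (exists2 m, (m < n)%N & P m); first exact: IH Pm.
by exists n => // m lt_mn Pm; apply: noP; exists m.
Qed.

(** * Upsets of N^t *)

(** [all2] rejects sequences of different lengths, so one predicate [U] can carry upsets of all
    dimensions at once. *)
Definition vle (a d : seq nat) := all2 leq a d.

Definition upset (U : seq nat -> Prop) := forall a d, vle a d -> U a -> U d.

Lemma vle_refl a : vle a a.
Proof. by elim: a => //= x a ->; rewrite leqnn. Qed.

Lemma vle_cons x a y d : vle (x :: a) (y :: d) = (x <= y) && vle a d.
Proof. by []. Qed.

Lemma upset_cons U i : upset U -> upset (fun d => U (i :: d)).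
Proof. by move=> uU a d le_ad; apply: uU; rewrite vle_cons leqnn. Qed.

Lemma upset_slice_le U i j d : upset U -> i <= j -> U (i :: d) -> U (j :: d).
Proof. by move=> uU le_ij; apply: uU; rewrite vle_cons le_ij vle_refl. Qed.

(** The slices of [U] at first coordinate [i] increase with [i], and their union is a finitely
    generated upset; by index [i0] all of its generators have appeared. Finite generation is a
    hypothesis because the lemma also serves inside the induction that proves it. *)
Lemma slices_stabilize t U :
  upset U ->
  (forall V, upset V -> exists gs : seq (seq nat),
      [/\ all (fun g => size g == t) gs, forall g, g \in gs -> V g
        & forall d, size d = t -> V d -> exists2 g, g \in gs & vle g d]) ->
  exists i0, forall i d, size d = t -> U (i :: d) -> U (i0 :: d).
Proof.
move=> uU fin.
have [|gs [_ gsU gsP]] := fin (fun d => exists i, U (i :: d)).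
  by move=> a d le_ad [i Ui]; exists i; apply: uU Ui; rewrite vle_cons leqnn.
have [i0 i0P] : exists i0, forall g, g \in gs -> U (i0 :: g).
  elim: gs gsU {gsP} => [|g gs IH] gsU; first by exists 0.
  have [g' g'_gs|i1 i1P] := IH; first by apply: gsU; rewrite inE g'_gs orbT.
  have [|i2 i2P] := gsU g; first by rewrite inE eqxx.
  exists (maxn i1 i2) => h; rewrite inE => /predU1P[->|/i1P].
    exact: upset_slice_le (leq_maxr _ _) i2P.
  exact: upset_slice_le (leq_maxl _ _).
exists i0 => i d sd Ud; have [|g g_gs le_gd] := gsP d sd; first by exists i.
by apply: uU (i0P g g_gs); rewrite vle_cons leqnn.
Qed.

(** From [i0] on the slices coincide, so generators of the slices 0, ..., [i0], with their index
    prepended, suffice: a vector with larger first coordinate lies above a generator of slice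
    [i0]. *)
Lemma dickson t U :
  upset U -> exists gs : seq (seq nat),
      [/\ all (fun g => size g == t) gs, forall g, g \in gs -> U g
        & forall d, size d = t -> U d -> exists2 g, g \in gs & vle g d].
Proof.
elim: t U => [|t IH] U uU.
  have [U0|U0] := classic (U [::]).
    exists [:: [::]]; split=> // [g|d /size0nil->]; first by rewrite inE => /eqP->.
    by exists [::].
  by exists [::]; split=> // d /size0nil->.
have [i0 i0P] := slices_stabilize uU IH.
have [gs [sgs gsU gsP]] : exists gs : seq (seq nat),
    [/\ all (fun g => size g == t.+1) gs, forall g, g \in gs -> U g
      & forall i d, i < i0.+1 -> size d = t -> U (i :: d) ->
          exists2 g, g \in gs & vle g (i :: d)].
  elim: i0.+1 => [|k [gs [sgs gsU gsP]]]; first by exists [::].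
  have [hs [shs hsU hsP]] := IH _ (upset_cons (i := k) uU).
  exists (map (cons k) hs ++ gs); split=> [|g|i d].
  - by rewrite all_cat all_map sgs andbT.
  - by rewrite mem_cat => /orP[/mapP[h /hsU Uh ->]|/gsU].
  rewrite ltnS leq_eqVlt => /predU1P[-> sd /(hsP d sd)[g g_hs le_gd]|lt_ik sd Ud].
    exists (k :: g); last by rewrite vle_cons leqnn.
    by rewrite mem_cat map_f.
  have [g g_gs le_gd] := gsP i d lt_ik sd Ud.
  by exists g => //; rewrite mem_cat g_gs orbT.
exists gs; split=> // -[//|i d] [sd] Ud.
have [lt_i0i|le_ii0] := ltnP i i0.+1; first exact: gsP.
have [g g_gs le_gd] := gsP i0 d (leqnn _) sd (i0P i d sd Ud).
exists g => //; case: g le_gd {g_gs} => // x g; rewrite !vle_cons => /andP[le_x ->].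
by rewrite andbT (leq_trans le_x) // ltnW.
Qed.

(* A piece is a translated coordinate face [a + N^F]; each coordinate carries its start and
   whether it belongs to [F]. *)
Definition piece := seq (nat * bool).

Definition in_piece (p : piece) (d : seq nat) :=
  all2 (fun q x => if q.2 then q.1 <= x else q.1 == x) p d.

Lemma in_piece_size p d : in_piece p d -> size p = size d.
Proof. by rewrite /in_piece all2E => /andP[/eqP]. Qed.

(** Each slice below [i0] contributes pieces with fixed first coordinate, and slice [i0] pieces
    whose first coordinate is free from [i0] on. Counting the pieces through [d] records covering
    and disjointness together. *)
Lemma coupset_decomposition t U :
  upset U -> exists ps : seq piece,
    all (fun p => size p == t) ps /\
    forall d, size d = t ->
      U d /\ count (in_piece^~ d) ps = 0 \/ ~ U d /\ count (in_piece^~ d) ps = 1.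
Proof.
elim: t U => [|t IH] U uU.
  have [U0|U0] := classic (U [::]); [exists [::] | exists [:: [::]]].
    by split=> // d /size0nil->; left.
  by split=> // d /size0nil->; right.
have [i0 i0P] := slices_stabilize uU (@dickson t).
have mapcE (q : nat * bool) i d ps : count (in_piece^~ (i :: d)) (map (cons q) ps) =
    (if q.2 then q.1 <= i else q.1 == i) * count (in_piece^~ d) ps.
  rewrite count_map; case Dq: (if _ then _ else _).
    by rewrite mul1n; apply: eq_count => p /=; rewrite /in_piece /= Dq.
  by rewrite mul0n -(count_pred0 ps); apply: eq_count => p /=; rewrite /in_piece /= Dq.
have [ps [sps psP psP']] : exists ps : seq piece,
    [/\ all (fun p => size p == t.+1) ps,
        forall i d, i < i0 -> size d = t ->
          U (i :: d) /\ count (in_piece^~ (i :: d)) ps = 0 \/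
          ~ U (i :: d) /\ count (in_piece^~ (i :: d)) ps = 1
      & forall i d, i0 <= i -> count (in_piece^~ (i :: d)) ps = 0].
  elim: {i0P} i0 => [|k [ps [sps psP psP']]]; first by exists [::].
  have [qs [sqs qsP]] := IH _ (upset_cons (i := k) uU).
  exists (map (cons (k, false)) qs ++ ps); split=> [|i d|i d lt_ki].
  - by rewrite all_cat all_map sps andbT.
  - rewrite ltnS leq_eqVlt count_cat mapcE /= => /predU1P[->|lt_ik] sd.
      by rewrite eqxx psP' // mul1n addn0; apply: qsP.
    by rewrite gtn_eqF // mul0n; apply: psP.
  by rewrite count_cat mapcE psP' 1?ltnW //= ltn_eqF.
have [qs [sqs qsP]] := IH _ (upset_cons (i := i0) uU).
exists (map (cons (i0, true)) qs ++ ps); split=> [|[//|i d] [sd]].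
  by rewrite all_cat all_map sps andbT.
rewrite count_cat mapcE /=; have [lt_ii0|le_i0i] := ltnP i i0; first exact: psP.
rewrite psP' // addn0 mul1n; have [[Ud ->]|[nUd ->]] := qsP d sd; [left | right].
  by split=> //; apply: upset_slice_le Ud.
by split=> // /(i0P _ _ sd).
Qed.

(** * Eventually polynomial counting *)

Section EventuallyPolynomial.
Local Open Scope ring_scope.

(** The differences (j+1)^(d+1) - j^(d+1) sum to n^(d+1); their binomial expansion expresses d+1
    times the sum of the j^d through sums of lower powers. *)
Lemma sum_poly_is_poly (q : {poly rat}) :
  exists Q : {poly rat}, forall n, \sum_(j < n) q.[j%:R] = Q.[n%:R].
Proof.
have powers d : exists Q : {poly rat}, forall n, \sum_(j < n) j%:R ^+ d = Q.[n%:R].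
  elim/ltn_ind: d => d IH.
  have [S SP] : exists S : {poly rat}, forall n,
      \sum_(i < d) \sum_(j < n) j%:R ^+ i *+ 'C(d.+1, i) = S.[n%:R].
    suff: forall e, (e <= d)%N -> exists S : {poly rat}, forall n,
      \sum_(i < e) \sum_(j < n) j%:R ^+ i *+ 'C(d.+1, i) = S.[n%:R] by apply.
    elim=> [|e IHe] le_ed; first by exists 0 => n; rewrite big_ord0 horner0.
    have [S SP] := IHe (ltnW le_ed); have [Q QP] := IH e le_ed.
    exists (S + Q *+ 'C(d.+1, e)) => n.
    by rewrite big_ord_recr /= SP sumrMnl QP hornerD hornerMn.
  exists (d.+1%:R^-1 *: ('X^(d.+1) - S)) => n.
  rewrite hornerZ hornerD hornerN hornerXn -SP exchange_big /=.
  have -> : n%:R ^+ d.+1 = \sum_(j < n) ((j.+1)%:R ^+ d.+1 - j%:R ^+ d.+1) :> rat.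
    by rewrite -(big_mkord predT (fun j => j.+1%:R ^+ d.+1 - j%:R ^+ d.+1))
      telescope_sumr // expr0n subr0.
  rewrite -sumrB mulr_sumr; apply: eq_bigr => j _.
  rewrite -[j.+1%:R]natr1 [j%:R + 1]addrC exprDn big_ord_recr big_ord_recr /=.
  under eq_bigr do rewrite expr1n mul1r.
  rewrite subnn subSnn expr0 expr1 !mul1r binn binSn.
  have ne0: d.+1%:R != 0 :> rat by rewrite pnatr_eq0.
  by rewrite mulr1n addrK [X in _ * X]addrC addKr -[_ ^+ d *+ _]mulr_natl mulKf.
have [S SP] : exists S : {poly rat}, forall n : nat,
    \sum_(i < size q) \sum_(j < n) q`_i * j%:R ^+ i = S.[n%:R].
  elim: (size q) => [|e [S SP]]; first by exists 0 => n; rewrite big_ord0 horner0.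
  have [Q QP] := powers e; exists (S + q`_e *: Q) => n.
  by rewrite big_ord_recr /= SP -mulr_sumr QP hornerD hornerZ.
exists S => n; rewrite -SP exchange_big; apply: eq_bigr => j _.
by rewrite horner_coef.
Qed.

(** Splitting off a natural root lowers the degree. This is why an eventually polynomial count is
    eventually zero or eventually nonzero. *)
Lemma poly_nat_root_bound (q : {poly rat}) :
  q != 0 -> exists N, forall n, (N <= n)%N -> q.[n%:R] != 0.
Proof.
have [m] := ubnP (size q); elim: m q => // m IH q le_qm q0.
have [[a qa0]|nor] := classic (exists a : nat, q.[a%:R] == 0); last first.
  by exists 0 => n _; apply/negP => qn; apply: nor; exists n.
have /factor_theorem[r Dq] : root q a%:R by exact: qa0.
have r0 : r != 0 by apply: contraNneq q0 => r0; rewrite Dq r0 mul0r.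
have [|N NP] := IH r _ r0.
  by move: le_qm; rewrite Dq size_Mmonic ?monicXsubC // size_XsubC addn2.
exists (maxn N a.+1) => n; rewrite geq_max => /andP[/NP rn lt_an].
by rewrite Dq hornerM mulf_neq0 // hornerXsubC subr_eq0 eqr_nat gtn_eqF.
Qed.

Definition ev_poly (f : nat -> nat) :=
  exists (q : {poly rat}) (N : nat), forall n, (N <= n)%N -> (f n)%:R = q.[n%:R].

Lemma ev_poly_eventually f g N :
  (forall n, (N <= n)%N -> f n = g n) -> ev_poly f -> ev_poly g.
Proof.
move=> fg [q [M qP]]; exists q, (maxn N M) => n.
by rewrite geq_max => /andP[/fg <- /qP].
Qed.

Lemma ev_poly_eq f g : f =1 g -> ev_poly f -> ev_poly g.
Proof. by move=> fg; apply: (@ev_poly_eventually _ _ 0) => n _. Qed.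

Lemma ev_poly_const a : ev_poly (fun=> a).
Proof. by exists a%:R%:P, 0%N => n _; rewrite hornerC. Qed.

Lemma ev_poly_add f g : ev_poly f -> ev_poly g -> ev_poly (fun n => f n + g n)%N.
Proof.
move=> [q [N qP]] [r [M rP]]; exists (q + r), (maxn N M) => n.
by rewrite geq_max natrD hornerD => /andP[/qP-> /rP->].
Qed.

Lemma ev_poly_shift f i : ev_poly f -> ev_poly (fun n => f (n - i)%N).
Proof.
move=> [q [N qP]]; exists (q \Po ('X - i%:R%:P)), (N + i)%N => n le_n.
have le_in : (i <= n)%N by apply: leq_trans le_n; apply: leq_addl.
by rewrite qP ?leq_subRL // 1?addnC // natrB // horner_comp hornerXsubC.
Qed.

Lemma ev_poly_sum (T : Type) (r : seq T) (P : pred T) (f : T -> nat -> nat) :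
  (forall i, ev_poly (f i)) -> ev_poly (fun n => \sum_(i <- r | P i) f i n)%N.
Proof.
move=> fP; elim: r => [|i r IH].
  by apply: ev_poly_eq (ev_poly_const 0) => n; rewrite big_nil.
case Pi: (P i); last by apply: ev_poly_eq IH => n; rewrite big_cons Pi.
by apply: ev_poly_eq (ev_poly_add (fP i) IH) => n; rewrite big_cons Pi.
Qed.

Lemma ev_poly_partial_sum f : ev_poly f -> ev_poly (fun n => \sum_(j < n.+1) f j)%N.
Proof.
move=> [q [N qP]]; have [Q QP] := sum_poly_is_poly q.
(* Below [N] the values of [f] and [q] may differ; this changes all later partial sums by one
   constant. *)
exists (Q \Po ('X + 1%:P) + (\sum_(j < N) ((f j)%:R - q.[j%:R]))%:P), N => n le_Nn.
rewrite hornerD hornerC horner_comp hornerD hornerX hornerC natr1 -QP natr_sum.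
rewrite -(big_mkord predT (fun j => (f j)%:R)) -(big_mkord predT (fun j => q.[j%:R])).
rewrite -(big_mkord predT (fun j => (f j)%:R - q.[j%:R])).
rewrite !(big_cat_nat (leq0n N) (leqW le_Nn)) /= sumrB.
rewrite [\sum_(N <= j < n.+1) (f j)%:R](eq_big_nat _ _ (F2 := fun j => q.[j%:R])); first by ring.
by move=> j /andP[/qP].
Qed.

End EventuallyPolynomial.

(** * Vectors of a piece with prescribed sum and linear cost *)

Section CountingPieces.
Local Open Scope ring_scope.

Fixpoint comps (t n : nat) : seq (seq nat) :=
  if t is t'.+1 then flatten [seq map (cons i) (comps t' (n - i)) | i <- iota 0 n.+1]
  else if n == 0%N then [:: [::]] else [::].

Lemma mem_comps t n d : (d \in comps t n) = (size d == t) && (sumn d == n).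
Proof.
elim: t n d => [|t IH] n [|x d].
- by rewrite /=; case: n => // n; rewrite inE.
- by rewrite /=; case: n.
- by apply/negbTE/negP => /flattenP[_ /mapP[i _ ->] /mapP[]].
apply/flattenP/andP => [[_ /mapP[i i_n ->] /mapP[e e_t [-> ->]]]|].
  move: e_t i_n; rewrite IH mem_iota /= eqSS => /andP[-> /eqP->] le_i.
  by rewrite subnKC ?eqxx.
rewrite [size _]/= [sumn _]/= eqSS => -[sd /eqP Dn].
exists (map (cons x) (comps t (n - x))).
  by apply/mapP; exists x => //; rewrite mem_iota /= add0n ltnS -Dn leq_addr.
by rewrite map_f // IH sd -Dn addKn eqxx.
Qed.

Lemma comps_uniq t n : uniq (comps t n).
Proof.
elim: t n => [|t IH] n; first by rewrite /=; case: eqP.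
suff: forall r, uniq r -> uniq (flatten [seq map (cons i) (comps t (n - i)) | i <- r]).
  by apply; apply: (iota_uniq 0 n.+1).
elim=> //= i r IHr /andP[ir ur]; rewrite cat_uniq map_inj_uniq ?IH => [|d e [] //].
rewrite IHr // andbT; apply/hasPn => d /flattenP[_ /mapP[j jr ->] /mapP[e _ ->]].
by apply: contra ir => /mapP[f _ [<- _]].
Qed.

Lemma count_comps_cons (Q : pred (seq nat)) t n :
  count Q (comps t.+1 n) =
  (\sum_(i < n.+1) count (fun d => Q (nat_of_ord i :: d)) (comps t (n - i)))%N.
Proof.
rewrite -(big_mkord predT (fun i => count (fun d => Q (i :: d)) (comps t (n - i)))).
rewrite -[comps t.+1 n]/(flatten _) count_flatten sumnE big_map big_map /index_iota subn0.
by apply: eq_bigr => i _; rewrite count_map.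
Qed.

Fixpoint cost (cs : seq int) (d : seq nat) : int :=
  match cs, d with c :: cs', x :: d' => c * x%:Z + cost cs' d' | _, _ => 0 end.

Definition free_cost_ge0 (p : piece) (cs : seq int) :=
  all (fun qc : nat * bool * int => qc.1.2 ==> (0 <= qc.2)) (zip p cs).

Definition starts (p : piece) : seq nat := map fst p.

Definition piece_count p cs n (k : int) :=
  count (fun d => in_piece p d && (cost cs d == k)) (comps (size p) n).

Lemma cost_in_piece p cs d : size cs = size p ->
  free_cost_ge0 p cs -> in_piece p d -> cost cs (starts p) <= cost cs d.
Proof.
rewrite /free_cost_ge0 /in_piece.
elim: p cs d => [|[a b] p IH] [|c cs] [|x d] //= [scs] /andP[c0 cs0] /andP[ax pd].
apply: lerD (IH _ _ scs cs0 pd).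
case: b c0 ax => /= [c0 le_ax|_ /eqP->//].
by apply: ler_wpM2l.
Qed.

(** Induction on the coordinates. If the first is fixed, it shifts [n]; if free of cost zero, it
    gives a partial sum; if free of positive cost, it takes finitely many values, the remaining cost
    being bounded below. *)
Lemma ev_poly_piece_count p cs k :
  size cs = size p -> free_cost_ge0 p cs -> ev_poly (fun n => piece_count p cs n k).
Proof.
elim: p cs k => [|[a b] p IH] [|c cs] k //= => [_ _|[scs] /= /andP[/= c0 cs0]].
  by apply: (@ev_poly_eventually (fun=> 0%N) _ 1) (ev_poly_const 0) => -[].
have countE n : piece_count ((a, b) :: p) (c :: cs) n k =
    (\sum_(i < n.+1 | if b then (a <= i)%N else a == i)
       piece_count p cs (n - i) (k - c * i%:Z))%N.
  rewrite /piece_count /= -/(comps (size p).+1 n) count_comps_cons [RHS]big_mkcond /=.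
  apply: eq_bigr => i _; rewrite /in_piece /=; case: (if b then _ else _) => /=.
    by apply: eq_count => d /=; congr andb; rewrite [c * _ + _]addrC [RHS]eq_sym subr_eq eq_sym.
  by rewrite -(count_pred0 (comps (size p) (n - i))); apply: eq_count.
case: b c0 countE => /= c0 countE; last first.
  apply: (@ev_poly_eventually (fun n => piece_count p cs (n - a) (k - c * a%:Z)) _ a).
    move=> n le_an; rewrite countE.
    by rewrite (big_pred1 (Ordinal (le_an : a < n.+1)%N)).
  exact: (ev_poly_shift _ (IH cs (k - c * a%:Z) scs cs0)).
have [c_eq0|c_neq0] := eqVneq c 0.
  apply: (@ev_poly_eventually
    (fun n => (\sum_(j < (n - a).+1) piece_count p cs j k)%N) _ a).
    move=> n le_an; rewrite countE c_eq0.
    rewrite -(big_mkord (fun i => a <= i)%N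
      (fun i => piece_count p cs (n - i) (k - 0 * i%:Z)))%N.
    rewrite (big_cat_nat (leq0n a) (leqW le_an)) big_nat_cond big_pred0 ?add0n /=; last first.
      by move=> i; case: (ltnP i a) => //= /ltn_geF ->.
    rewrite -[X in index_iota X _]add0n big_addn subSn // big_mkord.
    rewrite [LHS](reindex_inj rev_ord_inj) /=.
    rewrite [RHS]big_mkcond /=; apply: eq_bigr => i _.
    rewrite leq_addl mul0r subr0; congr piece_count.
    by rewrite subSS addnC subnDA.
  exact: (ev_poly_shift _ (ev_poly_partial_sum (IH cs k scs cs0))).
(* The remaining coordinates cost at least [K], so a first coordinate i satisfies c i <= k - K;
   since c >= 1, every i >= [M] is excluded. *)
set K := cost cs (starts p); pose M := (absz (k - K)).+1.
apply: (@ev_poly_eventually (fun n =>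
    \sum_(i <- iota 0 M | (a <= i)%N) piece_count p cs (n - i) (k - c * i%:Z))%N _ M).
  move=> n le_Mn; rewrite countE.
  rewrite -(big_mkord (fun i => a <= i)%N
    (fun i => piece_count p cs (n - i) (k - c * i%:Z)))%N.
  rewrite (big_cat_nat (leq0n M) (leqW le_Mn)) /= /index_iota subn0 -[LHS]addn0; congr addn.
  rewrite -/(index_iota _ _) big_nat_cond big1 // => i /andP[/andP[le_Mi _] _].
  apply/eqP; rewrite -leqn0 leqNgt -has_count; apply/hasPn => d _.
  apply/negP => /andP[/(cost_in_piece scs cs0) le_Kd /eqP Dd].
  by move: le_Mi le_Kd c_neq0; rewrite {}Dd -/K /M; nia.
by apply: ev_poly_sum => i; apply: (ev_poly_shift _ (IH cs (k - c * i%:Z) scs cs0)).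
Qed.

End CountingPieces.

(** * Counting vectors of maximal weight *)

Section MaximalWeight.
Local Open Scope ring_scope.

Lemma seq_max (T : eqType) (F : T -> nat) (r : seq T) :
  r != [::] -> exists2 x, x \in r & forall y, y \in r -> (F y <= F x)%N.
Proof.
elim: r => // x r IH _; have [->|/IH[y yr ymax]] := eqVneq r [::].
  by exists x => [|y]; rewrite ?inE // => /eqP->.
have [le_xy|/ltnW le_yx] := leqP (F x) (F y).
  by exists y => [|z]; rewrite !inE ?yr ?orbT // => /predU1P[->|/ymax].
exists x => [|z]; rewrite !inE ?eqxx // => /predU1P[->//|/ymax/leq_trans]; exact.
Qed.

Fixpoint weight (ws d : seq nat) : nat :=
  match ws, d with w :: ws', x :: d' => (w * x + weight ws' d')%N | _, _ => 0%N end.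

(* With [s] the largest weight of a free coordinate, all free coordinates have cost >= 0, so
   maximising the weight at fixed degree means minimising a cost that is bounded below. *)
Definition costs (s : nat) (ws : seq nat) : seq int := [seq s%:Z - w%:Z | w <- ws].

Lemma cost_weight s ws d : size ws = size d ->
  cost (costs s ws) d + (weight ws d)%:Z = s%:Z * (sumn d)%:Z.
Proof.
elim: ws d => [|w ws IH] [|x d] //= => [_|[/IH IHd]]; first by rewrite mulr0.
by rewrite !PoszD PoszM mulrDr -IHd; ring.
Qed.

Lemma free_cost_ge0_costs s p ws :
  free_cost_ge0 p (costs s ws) =
  all (fun q : nat * bool * nat => q.1.2 ==> (q.2 <= s)%N) (zip p ws).
Proof.
rewrite /free_cost_ge0; elim: p ws => [|[a b] p IH] [|w ws] //=.
by rewrite IH subr_ge0 lez_nat.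
Qed.

Lemma in_piece_starts p : in_piece p (starts p).
Proof. by rewrite /in_piece; elim: p => //= -[a []] p -> /=; rewrite ?leqnn ?eqxx. Qed.

(** The excess of [n] over the corner goes into the free coordinate of weight [s], whose cost s - s
    is zero. Hence the cost of the corner occurs in every large degree. *)
Lemma free_coordinate_witness s p ws a n :
  size ws = size p -> ((a, true), s) \in zip p ws -> (sumn (starts p) <= n)%N ->
  exists d, [/\ in_piece p d, sumn d = n &
                cost (costs s ws) d = cost (costs s ws) (starts p)].
Proof.
elim: p ws n => [|[x b] p IH] [|w ws] //= n [sws].
rewrite inE => /predU1P[[<- <- <-] le_n|in_p le_n].
  exists ((n - sumn (starts p))%N :: starts p); split=> /=.
  - by rewrite /in_piece /= -/(in_piece _ _) in_piece_starts andbT; lia.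
  - by rewrite subnK //; lia.
  - by rewrite subrr !mul0r.
have [|d [pd sd cd]] := IH ws (n - x)%N sws in_p; first by lia.
exists (x :: d); split=> /=; last by rewrite cd.
  by rewrite /in_piece /= -/(in_piece _ _) pd leqnn eqxx; case: b.
by rewrite sd; lia.
Qed.

Lemma in_piece_nofree p d : ~~ has snd p -> in_piece p d -> d = starts p.
Proof.
rewrite /in_piece; elim: p d => [|[a b] p IH] [|x d] //=.
by case: b => //= /IH IHp /andP[/eqP-> /IHp->].
Qed.

Lemma sum_count_pieces (ps : seq piece) (C : pred (seq nat)) (L : seq (seq nat)) :
  (forall d, d \in L -> (count (in_piece^~ d) ps <= 1)%N) ->
  (\sum_(p <- ps) count (fun d => in_piece p d && C d) L)%N =
  count (fun d => has (in_piece^~ d) ps && C d) L.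
Proof.
elim: L => [_|d L IH le1] /=; first by rewrite big1.
rewrite big_split /= IH => [|e eL]; last by apply: le1; rewrite inE eL orbT.
congr addn; have := le1 d (mem_head _ _); rewrite has_count.
case: (C d); last by move=> _; rewrite andbF big1 // => p _; rewrite andbF.
have -> : (\sum_(p <- ps) (in_piece p d && true))%N = count (in_piece^~ d) ps.
  rewrite -sum1_count [RHS]big_mkcond; apply: eq_bigr => p _ /=.
  by rewrite andbT; case: (in_piece p d).
by rewrite andbT; case: (count _ _) => [|[]].
Qed.

Definition max_weight_in (B : pred (seq nat)) ws (L : seq (seq nat)) : pred (seq nat) :=
  fun d => B d && all (fun e => B e ==> (weight ws e <= weight ws d)%N) L.

(** [U] is only a [Prop], while counting needs a boolean test; lying in one of the finitely many
    pieces provides [B]. *)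
Lemma ev_poly_max_weight_count t ws U :
  size ws = t -> upset U -> exists B : pred (seq nat),
    (forall d, size d = t -> B d <-> ~ U d) /\
    ev_poly (fun n => count (max_weight_in B ws (comps t n)) (comps t n)).
Proof.
move=> sws uU; have [ps [sps psP]] := coupset_decomposition t uU.
pose B d := has (in_piece^~ d) ps; exists B.
split=> [d /psP|]; first by rewrite /B has_count; case=> -[Ud ->]; split.
have sizeP p : p \in ps -> size p = t by move/(allP sps)/eqP.
(* The free coordinates of all pieces with their weights: [s] is the maximum over this common list,
   so one cost function serves every piece. *)
pose fl := [seq q <- flatten [seq zip p ws | p <- ps] | q.1.2].
have [fl0|/(seq_max snd)[[[a b] s] /= a_fl smax]] := eqVneq fl [::].
  (* Without free coordinates each piece is a single vector, and [N] exceeds the sum of each of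
     them. *)
  pose N := (\sum_(p <- ps) sumn (starts p)).+1%N.
  apply: (@ev_poly_eventually (fun=> 0%N) _ N) (ev_poly_const 0) => n le_Nn.
  apply/esym/eqP; rewrite -leqn0 leqNgt -has_count; apply/hasPn => d.
  rewrite mem_comps => /andP[_ /eqP Dn]; apply/negP => /andP[/hasP[p p_ps pd] _].
  move: le_Nn; rewrite -Dn (in_piece_nofree _ pd).
    by rewrite /N (big_rem p) //= -ltn_subRL subnn.
  rewrite -(@unzip1_zip _ _ p ws) ?sizeP ?sws // has_map; apply/hasPn => q q_p /=.
  apply/negP => fq; suff: q \in fl by rewrite fl0.
  rewrite mem_filter fq; apply/flattenP; exists (zip p ws) => //.
  exact: (map_f (fun p => zip p ws)).
pose cs := costs s ws.
have scs p : p \in ps -> size cs = size p by move=> /sizeP->; rewrite size_map.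
have cs0 p : p \in ps -> free_cost_ge0 p cs.
  move=> p_ps; rewrite free_cost_ge0_costs; apply/allP => q q_p; apply/implyP => fq.
  apply: smax; rewrite mem_filter fq; apply/flattenP; exists (zip p ws) => //.
  exact: (map_f (fun p => zip p ws)).
have [K KP] : exists K, forall d, B d -> K <= cost cs d.
  (* This lies below the cost of every corner, and a corner has the least cost of its piece. *)
  exists (- \sum_(p <- ps) `|cost cs (starts p)|) => d /hasP[p p_ps pd].
  apply: le_trans (cost_in_piece (scs p p_ps) (cs0 p p_ps) pd).
  rewrite lerNl (big_rem p) //= (le_trans (ler_norm _)) // normrN lerDl.
  by apply: sumr_ge0.
pose Bcnt k n := count (fun d => B d && (cost cs d == k)) (comps t n).
have BcntP k : ev_poly (Bcnt k).
  apply: (@ev_poly_eq (fun n => \sum_(p <- ps) piece_count p cs n k)%N).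
    move=> n; rewrite /Bcnt -sum_count_pieces; last first.
      by move=> d; rewrite mem_comps => /andP[/eqP/psP[][_ ->]].
    by apply: eq_big_seq => p /sizeP sp; rewrite /piece_count sp.
  suff: forall qs, {subset qs <= ps} -> ev_poly (fun n => \sum_(p <- qs) piece_count p cs n k)%N.
    by apply.
  elim=> [_|q qs IH qsP]; first by apply: ev_poly_eq (ev_poly_const 0) => n; rewrite big_nil.
  have q_ps : q \in ps by apply: qsP; rewrite mem_head.
  have {}IH : ev_poly (fun n => \sum_(p <- qs) piece_count p cs n k)%N.
    by apply: IH => p p_qs; apply: qsP; rewrite inE p_qs orbT.
  apply: ev_poly_eq (ev_poly_add (ev_poly_piece_count k (scs q q_ps) (cs0 q q_ps)) IH).
  by move=> n; rewrite big_cons.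
pose ev_zero k := exists N, forall n, (N <= n)%N -> Bcnt k n = 0%N.
(* [K + j] is the lowest cost met in infinitely many degrees; the corner of a piece with a free
   coordinate of weight [s] shows that such a cost exists. *)
have [|j nz_j z_lt] := @classic_least (fun j => ~ ev_zero (K + j%:Z)).
  move: a_fl; rewrite mem_filter /= => /andP[b_true /flattenP[_ /mapP[p p_ps ->]]].
  rewrite {}b_true => /(free_coordinate_witness (esym (etrans (sizeP p p_ps) (esym sws)))) wit.
  have le_K : K <= cost cs (starts p).
    by apply: KP; apply/hasP; exists p; rewrite ?in_piece_starts.
  exists (absz (cost cs (starts p) - K)).
  rewrite gez0_abs ?subr_ge0 // subrKC => -[N NP].
  have [d [pd sd cd]] := wit _ (leq_maxr N (sumn (starts p))).
  have /eqP := NP _ (leq_maxl N (sumn (starts p))).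
  rewrite -leqn0 leqNgt -has_count => /hasPn/(_ d); rewrite mem_comps sd eqxx.
  rewrite -(in_piece_size pd) (sizeP p p_ps) eqxx cd eqxx andbT => /(_ isT)/negP; apply.
  by rewrite andbT; apply/hasP; exists p.
have [N1 N1P] : exists N, forall n, (N <= n)%N -> forall i, (i < j)%N -> Bcnt (K + i%:Z) n = 0%N.
  elim: j z_lt {nz_j} => [|j IH] z_lt; first by exists 0%N.
  have [i lt_ij|N1 N1P] := IH; first by apply: z_lt; apply: ltnW.
  have /NNPP[N2 N2P] := z_lt j (leqnn _).
  exists (maxn N1 N2) => n; rewrite geq_max => /andP[/N1P z1 /N2P z2] i.
  by rewrite ltnS leq_eqVlt => /predU1P[->|/z1].
have [q [N2 qP]] := BcntP (K + j%:Z).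
(* As [q] is nonzero, cost [K + j] is met in every large degree; lower costs no longer occur there,
   so it is the minimum. *)
have [|N3 q_neq0] := @poly_nat_root_bound q.
  apply/eqP => q0; apply: nz_j; exists N2 => n /qP/eqP.
  by rewrite q0 horner0 pnatr_eq0 => /eqP.
apply: (@ev_poly_eventually (Bcnt (K + j%:Z)) _ (maxn N1 (maxn N2 N3))) (BcntP _) => n.
rewrite !geq_max => /and3P[/N1P z_n le_N2 /q_neq0].
rewrite -qP // pnatr_eq0 -lt0n -has_count => /hasP[e0 e0_n /andP[Be0 /eqP ce0]].
have ge_k e : e \in comps t n -> B e -> K + j%:Z <= cost cs e.
  move=> e_n Be; rewrite leNgt; apply/negP => lt_e.
  have le_K := KP e Be; have lt_j : (absz (cost cs e - K) < j)%N by lia.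
  have /eqP := z_n _ lt_j; rewrite -leqn0 leqNgt -has_count => /hasPn/(_ e e_n)/negP.
  by rewrite Be gez0_abs ?subr_ge0 // subrKC eqxx.
have wE d : d \in comps t n -> (weight ws d)%:Z = s%:Z * n%:Z - cost cs d.
  rewrite mem_comps => /andP[/eqP sd /eqP <-].
  by rewrite -(cost_weight s (etrans sws (esym sd))) [cost _ _ + _]addrC addrK.
apply: eq_in_count => d d_n; rewrite /max_weight_in; case Bd: (B d) => //=.
apply/eqP/allP => [cd e e_n|dmax].
  by apply/implyP => Be; rewrite -lez_nat !wE // cd lerD2l lerN2 ge_k.
apply: le_anti; rewrite ge_k // andbT -ce0 -lerN2 -(lerD2l (s%:Z * n%:Z)) -!wE //.
by have := dmax e0 e0_n; rewrite Be0.
Qed.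

End MaximalWeight.

(** * Finite Krull dimension *)

Section Dimension.
Local Open Scope ring_scope.

Section IdealFacts.
Variable R : comNzRingType.
Implicit Types (I P Q : R -> Prop).

Lemma ideal_sum I (T : Type) (r : seq T) (A : pred T) (F : T -> R) :
  is_ideal I -> (forall t, A t -> I (F t)) -> I (\sum_(t <- r | A t) F t).
Proof. by move=> [I0 ID _] IF; apply: (big_ind I). Qed.

Lemma ideal_opp I f : is_ideal I -> I f -> I (- f).
Proof. by move=> [_ _ IM] If; rewrite -mulN1r; apply: IM. Qed.

Lemma ideal_sub I f g : is_ideal I -> I f -> I g -> I (f - g).
Proof. by move=> idI If Ig; case: (idI) => _ ID _; apply: ID (ideal_opp idI Ig). Qed.

Lemma ideal_mulr I f g : is_ideal I -> I f -> I (f * g).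
Proof. by move=> [_ _ IM] If; rewrite mulrC; apply: IM. Qed.

Lemma ideal_cancel I f g : is_ideal I -> I (f + g) -> I g -> I f.
Proof. by move=> idI Ifg /(ideal_sub idI Ifg); rewrite addrK. Qed.

Lemma prime_exp P f n : is_prime P -> P (f ^+ n) -> P f.
Proof.
move=> [_ P1 PM]; elim: n => [/P1//|n IH].
by rewrite exprS => /PM[].
Qed.

Lemma prime_prod P (T : Type) (r : seq T) (A : pred T) (F : T -> R) :
  is_prime P -> P (\prod_(t <- r | A t) F t) -> exists2 t, A t & P (F t).
Proof.
move=> [_ P1 PM]; elim: r => [|t r IH]; first by rewrite big_nil => /P1.
by rewrite big_cons; case: ifP => [At /PM[Pt|/IH//]|_ /IH//]; exists t.
Qed.

Lemma ideal_gen_ideal (G : R -> Prop) : is_ideal (ideal_gen G).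
Proof.
split=> [J [J0 _ _] _|f g If Ig J idJ GJ|a f If J idJ GJ] //.
  by case: (idJ) => _ JD _; apply: JD; [apply: If | apply: Ig].
by case: (idJ) => _ _ JM; apply: JM; apply: If.
Qed.

Lemma ideal_gen_in (G : R -> Prop) g : G g -> ideal_gen G g.
Proof. by move=> Gg J _; apply. Qed.

End IdealFacts.

Lemma preim_ideal (R S : comNzRingType) (f : {rmorphism R -> S}) I :
  is_ideal I -> is_ideal (fun x => I (f x)).
Proof.
move=> [I0 ID IM]; split=> [|x y Ix Iy|a x Ix]; first by rewrite rmorph0.
  by rewrite rmorphD; apply: ID.
by rewrite rmorphM; apply: IM.
Qed.

Lemma preim_prime (R S : comNzRingType) (f : {rmorphism R -> S}) P :
  is_prime P -> is_prime (fun x => P (f x)).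
Proof.
move=> [idP P1 PM]; split; first exact: preim_ideal.
  by rewrite rmorph1.
by move=> x y; rewrite rmorphM => /PM.
Qed.

Definition chain (R : comNzRingType) (h : nat) (Q : nat -> R -> Prop) :=
  (forall i, (i <= h)%N -> is_prime (Q i)) /\
  (forall i, (i < h)%N -> sub_ideal (Q i) (Q i.+1) /\ ~ sub_ideal (Q i.+1) (Q i)).

Definition dim_le (R : comNzRingType) (d : nat) :=
  forall h (Q : nat -> R -> Prop), chain h Q -> (h <= d)%N.

Lemma dim_le_field (F : fieldType) : dim_le F 0.
Proof.
move=> [//|h] Q [Qpr Qlt]; have [_ []] := Qlt 0%N isT => x.
have [[Q0 _ _] _ _] := Qpr 0%N isT; have [idQ Q1 _] := Qpr 1%N isT.
have [->//|x_neq0] := eqVneq x 0.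
by move=> /(ideal_mulr x^-1 idQ); rewrite divff.
Qed.

Lemma dim_le_surj (R S : comNzRingType) (f : {rmorphism R -> S}) d :
  (forall y, exists x, y = f x) -> dim_le R d -> dim_le S d.
Proof.
move=> surj dimR h Q [Qpr Qlt]; apply: (dimR h (fun i x => Q i (f x))).
split=> i lt_i; first by apply: preim_prime; apply: Qpr.
have [le_Q nle_Q] := Qlt i lt_i; split=> [x|le_f]; first exact: le_Q.
by apply: nle_Q => y; have [x ->] := surj y; apply: le_f.
Qed.

Section PolyContraction.
Variable A : idomainType.
Implicit Types (Q : {poly A} -> Prop) (p : A -> Prop) (f g : {poly A}).

(** For an ideal [p] this is the extended ideal p A[x]. *)
Definition coefs_in p f := forall i, p f`_i.

Lemma coefs_in_ideal p : is_ideal p -> is_ideal (coefs_in p).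
Proof.
move=> idp; case: (idp) => [p0 pD pM]; split=> [i|f g pf pg i|f g pg i].
- by rewrite coef0.
- by rewrite coefD; apply: pD.
by rewrite coefM; apply: ideal_sum => // j _; apply: pM.
Qed.

Lemma coefs_in_contraction Q f :
  is_ideal Q -> coefs_in (fun a => Q a%:P) f -> Q f.
Proof.
move=> idQ pf; rewrite -[f]coefK poly_def; apply: ideal_sum => // i _.
by rewrite -mul_polyC; apply: ideal_mulr.
Qed.

(** [r] has least size among the elements of [Q] outside p A[x]. Were its leading coefficient in
    [p], its leading term would lie in [Q] and in p A[x], and removing it would leave a smaller such
    element. *)
Lemma minimal_lead_coef Q :
  let p a := Q a%:P in
  is_ideal Q -> (exists2 f, Q f & ~ coefs_in p f) ->
  exists r, [/\ Q r, ~ p (lead_coef r) &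
               forall g, Q g -> (size g < size r)%N -> coefs_in p g].
Proof.
move=> p idQ nonp.
have [|m [r Qr [npr szr]] mmin] :=
    @classic_least (fun m => exists2 r, Q r & ~ coefs_in p r /\ size r = m).
  by have [f Qf npf] := nonp; exists (size f), f.
exists r; split=> // [plr|g Qg lt_gr]; last first.
  by apply: NNPP => npg; rewrite szr in lt_gr; apply: (mmin _ lt_gr); exists g.
have idp : is_ideal p by apply: preim_ideal.
have Qlead : Q (lead_coef r *: 'X^((size r).-1)).
  by rewrite -mul_polyC; apply: ideal_mulr.
have r_neq0 : r != 0.
  by apply/eqP => r0; case: npr => i; rewrite r0 coef0; case: idp.
pose g := r - lead_coef r *: 'X^((size r).-1).
have lt_gr : (size g < m)%N.
  rewrite -szr -[size r]prednK ?size_poly_gt0 // ltnS; apply/leq_sizeP => j.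
  rewrite leq_eqVlt coefB coefZ coefXn => /predU1P[<-|lt_j].
    by rewrite eqxx mulr1 subrr.
  by rewrite gtn_eqF // mulr0 subr0 nth_default // -(prednK (n := size r)) ?size_poly_gt0.
apply: (mmin _ lt_gr); exists g; first exact: ideal_sub.
split=> // pg; apply: npr.
have [_ pD _] := coefs_in_ideal idp.
rewrite -[r](subrK (lead_coef r *: 'X^((size r).-1))); apply: pD => // i.
by rewrite coefZ; apply: ideal_mulr.
Qed.

(* Modulo the common contraction [p], the rings become [K[x]] with [K = Frac(A/p)], where
   a nonzero prime is maximal; pseudo-division replaces the passage to [K]. *)
Lemma no_three_primes Q0 Q1 Q2 :
  is_prime Q0 -> is_prime Q1 -> is_prime Q2 ->
  sub_ideal Q0 Q1 -> sub_ideal Q1 Q2 ->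
  ~ sub_ideal Q1 Q0 -> ~ sub_ideal Q2 Q1 ->
  ~ (forall a, Q2 a%:P -> Q0 a%:P).
Proof.
move=> pr0 pr1 pr2 le01 le12 nle10 nle21 eq_p.
have [[[id0 _ _] [id1 _ _]] [id2 _ _]] := (pr0, pr1, pr2).
pose p := fun a => Q2 a%:P.
have idp : is_ideal p by apply: preim_ideal.
have prp : is_prime p by apply: (preim_prime (@polyC A)).
have pQ1 g : coefs_in p g -> Q1 g.
  by move=> pg; apply: coefs_in_contraction => // i; apply/le01/eq_p/pg.
have [g0 Q1g0 nQ0g0] : exists2 g, Q1 g & ~ Q0 g.
  by apply: NNPP => noex; apply: nle10 => g Qg; apply: NNPP => nQg; apply: noex; exists g.
have npg0 : ~ coefs_in p g0.
  by move=> pg; apply/nQ0g0/(coefs_in_contraction id0) => i; apply/eq_p/pg.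
(* The contraction of [Q1] lies between those of [Q0] and [Q2], hence equals [p] as well. *)
have [f [Q1f npf fmin]] : exists f, [/\ Q1 f, ~ p (lead_coef f) &
    forall g, Q1 g -> (size g < size f)%N -> coefs_in p g].
  have [|f [Q1f npf fmin]] := minimal_lead_coef id1.
    by exists g0 => // pg; apply: npg0 => i; apply/le12/pg.
  exists f; split=> // [pf|g Qg lt_g i]; first by apply: npf; apply/le01/eq_p.
  exact/le12/(fmin g Qg lt_g i).
have [|r [Q2r npr rmin]] := minimal_lead_coef id2.
  by exists g0; first exact: le12.
have r_neq0 : r != 0.
  by apply/eqP => r0; apply: npr; rewrite r0 lead_coef0; case: idp.
have divE g := Pdiv.Idomain.divp_eq g r.
have remP g : Q2 g -> coefs_in p (g %% r).
  move=> Q2g; apply: rmin; last by rewrite ltn_modp.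
  apply: (ideal_cancel (g := g %/ r * r)) => //; last by case: id2 => _ _; apply.
  by rewrite addrC -divE -mul_polyC; case: id2 => _ _; apply.
have nlead k : ~ p (lead_coef r ^+ k) by move/(prime_exp prp)/npr.
(* Up to a power of [lead_coef r], [f] is a multiple of [r] modulo p A[x], which is contained in
   [Q1]; primality leaves the quotient or [r]. *)
have [Q1q|Q1r] : Q1 (f %/ r) \/ Q1 r.
- case: pr1 => _ _; apply; apply: (ideal_cancel (g := f %% r)) => //.
    by rewrite -divE -mul_polyC; case: id1 => _ _; apply.
  by apply/pQ1/remP/le12.
(* Since [r] is not constant, the quotient is smaller than [f] and falls into p A[x] by minimality;
   this forces a power of [lead_coef r] times [lead_coef f] into [p]. *)
- have gt1_r : (1 < size r)%N.
    rewrite ltnNge; apply/negP => /size1_polyC r_const; apply: npr.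
    by rewrite /p r_const lead_coefC -r_const.
  have f_neq0 : f != 0.
    by apply/eqP => f0; apply: npf; rewrite f0 lead_coef0; case: idp.
  have pq : coefs_in p (f %/ r).
    apply: fmin => //; rewrite Pdiv.Idomain.size_divp // ltn_subrL size_poly_gt0 f_neq0.
    by rewrite andbT -subn1 subn_gt0.
  have : p (lead_coef r ^+ scalp f r * lead_coef f).
    rewrite -[lead_coef f]/(f`_(size f).-1) -coefZ divE.
    have idX := coefs_in_ideal idp; have [_ XD _] := idX.
    have : coefs_in p (f %/ r * r + f %% r).
      by apply: XD (ideal_mulr r idX pq) _; apply/remP/le12.
    exact.
  by case: prp => _ _ pM /pM[|//]; apply: (nlead (scalp f r)).
(* With [r] in [Q1], division by [r] puts all of [Q2] into [Q1]. *)
apply: nle21 => g Q2g.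
have : Q1 ((lead_coef r ^+ scalp g r)%:P * g).
  rewrite mul_polyC divE; case: id1 => _ ID IM; apply: ID; first exact: IM.
  exact/pQ1/remP.
by case: pr1 => _ _ PM /PM[Q1b|//]; case: (nlead (scalp g r)); apply: le12.
Qed.

(* Every second prime of the chain has a strictly larger contraction to [A]. *)
Lemma dim_le_poly d : dim_le A d -> dim_le {poly A} d.*2.+1.
Proof.
move=> dimA h Q [Qpr Qlt]; rewrite -leq_half_double -ltnS.
suff: (h./2 <= d)%N by lia.
apply: (dimA _ (fun j a => Q j.*2 a%:P)); split=> j lt_j.
  by apply: (preim_prime (@polyC A)); apply: Qpr; lia.
have [|le01 nle10] := Qlt j.*2; first by lia.
have [|le12 nle21] := Qlt j.*2.+1; first by lia.
rewrite doubleS; split=> [a Qa|]; first exact/le12/le01.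
by apply: (no_three_primes _ _ _ le01 le12 nle10 nle21); apply: Qpr; lia.
Qed.

End PolyContraction.

End Dimension.

(** * Chains of primes and existence of heights *)

Section Height.
Local Open Scope ring_scope.

Definition has_chain (R : comNzRingType) (P : R -> Prop) h := exists Q, prime_chain_to P h Q.

Lemma has_chain_height (R : comNzRingType) (P : R -> Prop) h h' :
  has_chain P h -> prime_height P h' -> (h <= h')%N.
Proof. by move=> [Q cQ] [_ max_h']; apply: max_h' cQ. Qed.

Lemma has_chain_prime (R : comNzRingType) (P Q : R -> Prop) h :
  is_prime Q -> sub_ideal P Q -> ~ sub_ideal Q P -> has_chain P h -> has_chain Q h.+1.
Proof.
move=> prQ le_PQ nle_QP [c [cpr clt cP]].
exists (fun i => if (i <= h)%N then c i else Q); split=> [i _|i|].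
- by case: ifP => // /cpr.
- move=> lt_i; have /predU1P[->|lt_ih] : (i == h) || (i < h)%N by rewrite -leq_eqVlt -ltnS.
    rewrite leqnn ltnn; split=> [f /cP/le_PQ//|le_Q].
    by apply: nle_QP => f /le_Q /cP.
  by rewrite (ltnW lt_ih) lt_ih; apply: clt.
by rewrite ltnn.
Qed.

Lemma has_chain_eq (R : comNzRingType) (P Q : R -> Prop) h :
  eq_ideal P Q -> has_chain P h -> has_chain Q h.
Proof.
move=> eqPQ [c [cpr clt cP]]; exists c; split=> // f.
by split=> [/cP/eqPQ|/eqPQ/cP].
Qed.

Lemma has_chain0 (R : comNzRingType) (P : R -> Prop) : is_prime P -> has_chain P 0.
Proof. by move=> prP; exists (fun=> P); split. Qed.

(** [Q] replaces the last prime of the chain instead of being appended, so equality of [P] and [Q]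
    is allowed. *)
Lemma has_chain_sub (R : comNzRingType) (P Q : R -> Prop) h :
  is_prime Q -> sub_ideal P Q -> has_chain P h -> has_chain Q h.
Proof.
move=> prQ le_PQ [c]; case: h => [_|h [cpr clt cP]]; first exact: has_chain0.
have [le_ch nle_ch] := clt h (leqnn _).
apply: (@has_chain_prime _ (c h)) => // [f /le_ch/cP/le_PQ//|le_Qc|].
  by apply: nle_ch => f /cP/le_PQ/le_Qc.
exists c; split=> [i le_ih|i lt_ih|f //]; first exact/cpr/leqW.
by apply: clt; apply: leqW.
Qed.

Lemma has_chain_iso (R S : comNzRingType) (f : {rmorphism R -> S}) (g : S -> R) P h :
  cancel g f -> has_chain P h -> has_chain (fun x => P (f x)) h.
Proof.
move=> gK [c [cpr clt cP]]; exists (fun i x => c i (f x)); split=> [i le_ih|i lt_ih|x].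
- exact/preim_prime/cpr.
- have [le_c nle_c] := clt i lt_ih; split=> [x|le_f]; first exact: le_c.
  by apply: nle_c => y; rewrite -(gK y); apply: le_f.
exact: cP.
Qed.

Lemma prime_height_exists (R : comNzRingType) d (P : R -> Prop) :
  dim_le R d -> is_prime P -> exists h, prime_height P h.
Proof.
move=> dimR prP.
have [|e nch_e lt_e] := @classic_least (fun e => ~ has_chain P e).
  by exists d.+1 => -[Q [Qpr Qlt _]]; have := dimR _ Q (conj Qpr Qlt); rewrite ltnn.
case: e nch_e lt_e => [[]|e nch lt_e]; first exact: has_chain0.
exists e; split=> [|h Q cQ]; first exact: NNPP (lt_e e (ltnSn e)).
rewrite leqNgt; apply/negP => lt_eh; apply: nch.
have [Qpr Qlt QP] := cQ.
(* Dropping the [k] smallest primes of a chain longer than [e] leaves one of length exactly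
   [e.+1]. *)
have [k Dh] : exists k, h = (e.+1 + k)%N by exists (h - e.+1)%N; rewrite subnKC.
exists (fun i => Q (i + k)%N); split=> [i le_i|i lt_i|]; last by rewrite -Dh.
  by apply: Qpr; rewrite Dh leq_add2r.
by apply: Qlt; rewrite Dh ltn_add2r.
Qed.

End Height.

(** * Polynomial rings and primes generated by variables *)

Section Variables.
Local Open Scope ring_scope.
Variable k : fieldType.

Lemma mpoly_gen_ind n (S : {mpoly k[n]} -> Prop) :
  (forall a, S a%:MP) -> (forall i, S 'X_i) ->
  (forall f g, S f -> S g -> S (f + g)) -> (forall f g, S f -> S g -> S (f * g)) ->
  forall f, S f.
Proof.
move=> SC SX SD SM f; rewrite [f]mpolyE.
apply: (big_ind S) => // [|m _]; first by rewrite -mpolyC0; apply: SC.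
rewrite -mul_mpolyC; apply: (SM) => //; rewrite mpolyXE_id.
have S1 : S 1 by rewrite -mpolyC1; apply: SC.
apply: (big_ind S S1 SM) => i _.
by elim: (m i) => // e IH; rewrite exprS; apply: SM.
Qed.

(** Sending x to the last variable maps k[x_1, ..., x_n][x] onto the ring in n+1 variables, and
    prime chains pull back along surjections. The bound produced is 2^n - 1. *)
Lemma dim_le_mpoly n : exists d, dim_le {mpoly k[n]} d.
Proof.
elim: n => [|n [d dimn]].
  exists 0%N; apply: (dim_le_surj (f := @mpolyC 0 k)) (@dim_le_field k) => y.
  by elim/mpoly_gen_ind: y => [a|[]//|_ _ [a ->] [b ->]|_ _ [a ->] [b ->]];
    [exists a | exists (a + b); rewrite rmorphD | exists (a * b); rewrite rmorphM].
exists d.*2.+1; have cfX : commr_rmorph (@mwiden n k) 'X_ord_max by move=> ?; apply: mulrC.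
apply: (dim_le_surj (f := horner_morph cfX)) (dim_le_poly dimn) => y.
elim/mpoly_gen_ind: y => [a|i|_ _ [a ->] [b ->]|_ _ [a ->] [b ->]].
- by exists (a%:MP)%:P; rewrite /= horner_morphC -[RHS]/(mwiden _) mwidenC.
- have [->|ne_i] := eqVneq i ord_max; first by exists 'X; rewrite /= horner_morphX.
  have lt_in : (i < n)%N.
    by rewrite ltn_neqAle -ltnS ltn_ord andbT; apply: contra ne_i => /eqP Di; apply/eqP/val_inj.
  exists ('X_(Ordinal lt_in))%:P; rewrite /= horner_morphC -[RHS]/(mwiden _) mwidenX mnmwiden1.
  by congr 'X_[U_(_)]; apply: val_inj.
- by exists (a + b); rewrite rmorphD.
by exists (a * b); rewrite rmorphM.
Qed.

Definition rename m n (g : 'I_m -> 'I_n) : {mpoly k[m]} -> {mpoly k[n]} :=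
  comp_mpoly [tuple 'X_(g l) | l < m].

HB.instance Definition _ m n (g : 'I_m -> 'I_n) := GRing.RMorphism.on (rename g).

Lemma renameD m n (g : 'I_m -> 'I_n) : {morph rename g : x y / x + y}.
Proof. exact: rmorphD. Qed.

Lemma renameM m n (g : 'I_m -> 'I_n) : {morph rename g : x y / x * y}.
Proof. exact: rmorphM. Qed.

Lemma renameX m n (g : 'I_m -> 'I_n) l : rename g 'X_l = 'X_(g l).
Proof. by rewrite /rename comp_mpolyXU -tnth_nth tnth_mktuple. Qed.

Lemma renameC m n (g : 'I_m -> 'I_n) a : rename g a%:MP = a%:MP.
Proof. exact: comp_mpolyC. Qed.

Lemma rename_comp m n p (g : 'I_m -> 'I_n) (h : 'I_n -> 'I_p) f :
  rename h (rename g f) = rename (h \o g) f.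
Proof.
elim/mpoly_gen_ind: f => [a|i|f f' IH IH'|f f' IH IH'].
- by rewrite !renameC.
- by rewrite !renameX.
- by rewrite !renameD IH IH'.
by rewrite !renameM IH IH'.
Qed.

Lemma rename_id n (g : 'I_n -> 'I_n) f : g =1 id -> rename g f = f.
Proof.
move=> g_id; elim/mpoly_gen_ind: f => [a|i|f f' IH IH'|f f' IH IH'].
- by rewrite !renameC.
- by rewrite !renameX g_id.
- by rewrite !renameD IH IH'.
by rewrite !renameM IH IH'.
Qed.

Lemma renameK n (g h : 'I_n -> 'I_n) : cancel g h -> cancel (rename g) (rename h).
Proof. by move=> gK f; rewrite rename_comp rename_id. Qed.

Section VariablePrimes.
Variable n : nat.
Implicit Types (C D E : {set 'I_n}) (I P : {mpoly k[n]} -> Prop).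

Definition kill C : {mpoly k[n]} -> {mpoly k[n]} :=
  comp_mpoly [tuple if l \in C then 0 else 'X_l | l < n].

HB.instance Definition _ C := GRing.RMorphism.on (kill C).

Lemma killD C : {morph kill C : x y / x + y}.
Proof. exact: rmorphD. Qed.

Lemma killM C : {morph kill C : x y / x * y}.
Proof. exact: rmorphM. Qed.

Lemma killX C l : kill C 'X_l = if l \in C then 0 else 'X_l.
Proof. by rewrite /kill comp_mpolyXU -tnth_nth tnth_mktuple. Qed.

Lemma killC C a : kill C a%:MP = a%:MP.
Proof. exact: comp_mpolyC. Qed.

(** The ideal generated by the variables in [C], given as the kernel of a substitution so that
    primality follows from the target being a domain. *)
Definition var_prime C : {mpoly k[n]} -> Prop := fun f => kill C f = 0.

Definition face_mon D : {mpoly k[n]} := \prod_(l in D) 'X_l.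

Lemma var_prime_prime C : is_prime (var_prime C).
Proof.
rewrite /var_prime; split=> [||f g].
- split=> [|f g f0 g0|a f f0]; first by rewrite rmorph0.
    by rewrite killD f0 g0 addr0.
  by rewrite killM f0 mulr0.
- by rewrite rmorph1; apply/eqP/oner_neq0.
by rewrite killM => /eqP; rewrite mulf_eq0 => /orP[] /eqP; [left | right].
Qed.

Lemma mpolyX_neq0 l : 'X_l != 0 :> {mpoly k[n]}.
Proof. by rewrite -msize_poly_eq0 msizeX. Qed.

Lemma var_primeX C l : var_prime C 'X_l <-> l \in C.
Proof.
rewrite /var_prime killX; case: ifP => // _.
by split=> // /eqP; rewrite (negbTE (mpolyX_neq0 l)).
Qed.

Lemma face_mon_sub D E : D \subset E -> face_mon E = face_mon (E :\: D) * face_mon D.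
Proof. by move=> /setIidPr DE; rewrite /face_mon (big_setID D) DE mulrC. Qed.

Lemma face_mon_up D E P : is_ideal P -> D \subset E -> P (face_mon D) -> P (face_mon E).
Proof. by move=> [_ _ PM] /face_mon_sub->; apply: PM. Qed.

Lemma var_prime_face C D : var_prime C (face_mon D) <-> ~~ (D \subset ~: C).
Proof.
split=> [/(prime_prod (var_prime_prime C))[l lD /var_primeX lC]|/subsetPn[l lD]].
  by apply/subsetPn; exists l; rewrite ?inE ?lC.
rewrite inE negbK => lC; rewrite /face_mon (big_setD1 l) //=.
have [idC _ _] := var_prime_prime C.
by apply: ideal_mulr => //; apply/var_primeX.
Qed.

(** Modulo [P] every polynomial is congruent to its image under [kill C]. *)
Lemma var_prime_min C P :
  is_ideal P -> (forall l, l \in C -> P 'X_l) -> sub_ideal (var_prime C) P.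
Proof.
move=> idP PX f f0; rewrite -[f]subr0 -f0; have [P0 PD PM] := idP.
elim/mpoly_gen_ind: f {f0} => [a|i|f g Pf Pg|f g Pf Pg].
- by rewrite killC subrr.
- by rewrite killX; case: ifP => [iC|]; rewrite ?subrr // subr0; apply: PX.
- by rewrite killD opprD addrACA; apply: PD.
rewrite killM (_ : _ - _ = f * (g - kill C g) + kill C g * (f - kill C f)); last by ring.
by apply: PD; apply: PM.
Qed.

Lemma var_prime_sub C D : C \subset D -> sub_ideal (var_prime C) (var_prime D).
Proof.
move=> /subsetP CD; apply: var_prime_min; first by have [] := var_prime_prime D.
by move=> l /CD/var_primeX.
Qed.

End VariablePrimes.

Lemma var_prime_rename n (g h : 'I_n -> 'I_n) (C D : {set 'I_n}) f :
  cancel g h -> (forall l, (l \in C) = (g l \in D)) ->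
  var_prime D (rename g f) <-> var_prime C f.
Proof.
move=> gK CD; rewrite /var_prime.
have -> : kill D (rename g f) = rename g (kill C f).
  elim/mpoly_gen_ind: f => [a|i|f f' IH IH'|f f' IH IH'].
  - by rewrite renameC !killC renameC.
  - by rewrite renameX !killX CD; case: ifP; rewrite ?rmorph0 ?renameX.
  - by rewrite renameD !killD renameD IH IH'.
  by rewrite renameM !killM renameM IH IH'.
split=> [/(congr1 (rename h))|->]; last by rewrite rmorph0.
by rewrite (renameK gK) rmorph0.
Qed.

End Variables.

(** * Components of squarefree monomial ideals *)

Section SquarefreeIdeals.
Local Open Scope ring_scope.

Lemma is_prime_eq (R : comNzRingType) (P Q : R -> Prop) :
  eq_ideal Q P -> is_prime P -> is_prime Q.
Proof.
move=> QP [[P0 PD PM] P1 Ppr]; split=> [|/QP//|f g /QP/Ppr[/QP|/QP]]; [|by left|by right].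
by split=> [|f g /QP Pf /QP Pg|a f /QP Pf]; apply/QP => //; [apply: PD | apply: PM].
Qed.

Lemma colon_ideal (R : comNzRingType) (I : R -> Prop) f :
  is_ideal I -> is_ideal (fun g => I (f * g)).
Proof.
move=> [I0 ID IM]; split=> [|g h Ig Ih|a g Ig]; first by rewrite mulr0.
  by rewrite mulrDr; apply: ID.
by rewrite mulrCA; apply: IM.
Qed.

Lemma count_mktuple (T : eqType) n (f : 'I_n -> T) x :
  count_mem x (mktuple f) = #|[pred i | f i == x]|.
Proof. by rewrite /= count_map -sum1_count -sum1_card big_enum_cond; apply: eq_bigl. Qed.

Lemma perm_eq_reindex (T : eqType) n (f g : 'I_n -> T) :
  perm_eq (mktuple f) (mktuple g) -> exists s : 'S_n, forall i, f i = g (s i).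
Proof.
move=> /tuple_permP[s Ds]; exists s => i.
have /(congr1 (fun t : n.-tuple T => tnth t i)) :
    mktuple f = [tuple tnth (mktuple g) (s i) | i < n].
  exact: val_inj.
by rewrite !tnth_mktuple.
Qed.

(** The indicator functions of [C] and [D] take each boolean value equally often. *)
Lemma perm_set_of_card n (C D : {set 'I_n}) :
  #|C| = #|D| -> exists s : 'S_n, forall l, (l \in C) = (s l \in D).
Proof.
move=> eqCD; apply: (@perm_eq_reindex _ _ (fun l => l \in C) (fun l => l \in D)).
have cardT (A : {set 'I_n}) : #|[pred l | (l \in A) == true]| = #|A|.
  by apply: eq_card => l; rewrite !inE eqb_id.
have cardF (A : {set 'I_n}) : #|[pred l | (l \in A) == false]| = #|~: A|.
  by apply: eq_card => l; rewrite !inE eqbF_neg.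
have eqCD' : #|~: C| = #|~: D|.
  by apply/eqP; rewrite -(eqn_add2l #|C|) {2}eqCD !cardsC.
by apply/allP => -[] _; rewrite /= !count_mktuple ?cardT ?cardF ?eqCD ?eqCD'.
Qed.

Variables (k : fieldType) (n : nat).
Implicit Types (C D E : {set 'I_n}) (I P : {mpoly k[n]} -> Prop).

(* Exact heights are not needed: permuting variables shows that the height of a variable prime
   is a strictly increasing function of the number of its variables. *)
Lemma var_prime_chain_card C D h : (#|C| <= #|D|)%N ->
  has_chain (@var_prime k n C) h -> has_chain (@var_prime k n D) (h + (#|C| < #|D|))%N.
Proof.
move=> le_CD chC.
(* A permutation of the variables carries the chain from [C] to [E]; if [E] is proper in [D], the
   prime of [D] prolongs it by one. *)
have [E ED cardE] : exists2 E : {set 'I_n}, E \subset D & #|E| = #|C|.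
  have /card_geqP[r [ur sr rD]] := le_CD.
  exists [set l in r]; first by apply/subsetP => l; rewrite inE; apply: rD.
  by rewrite cardsE (card_uniqP ur).
have [s sEC] := perm_set_of_card cardE.
have chE : has_chain (@var_prime k n E) h.
  apply: has_chain_eq (has_chain_iso (f := rename s) (renameK (permKV s)) chC) => f.
  exact: (var_prime_rename _ (permK s)).
rewrite -cardE; case: ltnP => [lt_ED|le_DE]; rewrite ?addn0 ?addn1.
  apply: has_chain_prime (var_prime_prime _ _) (var_prime_sub ED) _ chE => le_DE.
  have [l lD lE] : exists2 l, l \in D & l \notin E.
    by apply/subsetPn; apply: contraL lt_ED => /subset_leq_card; rewrite -leqNgt.
  by have /var_primeX/(negP lE) := le_DE _ (proj2 (var_primeX k D l) lD).
by have /eqP <- : E == D by rewrite eqEcard ED.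
Qed.

Lemma var_prime_height C : exists h, prime_height (@var_prime k n C) h.
Proof.
have [d dimn] := dim_le_mpoly k n.
exact: prime_height_exists dimn (var_prime_prime k C).
Qed.

Definition squarefree_gens I (G : {set 'I_n} -> Prop) :=
  eq_ideal I (ideal_gen (fun f => exists2 D, G D & f = face_mon k D)).

Lemma mpolyX_squarefree (m : 'X_{1..n}) :
  (forall l, m l <= 1)%N -> 'X_[m] = face_mon k [set l | (0 < m l)%N].
Proof.
move=> le_m1; rewrite mpolyXE_id /face_mon [RHS]big_mkcond; apply: eq_bigr => l _.
by rewrite inE; case: (m l) (le_m1 l) => [|[]].
Qed.

Lemma squarefree_gensP I :
  (exists M : 'X_{1..n} -> Prop, (forall m, M m -> forall l, (m l <= 1)%N) /\
     eq_ideal I (ideal_gen (fun f => exists2 m, M m & f = 'X_[m]))) ->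
  exists G, squarefree_gens I G.
Proof.
move=> [M [M1 MI]].
exists (fun D => exists2 m, M m & D = [set l | (0 < m l)%N]) => f.
have eqG g : (exists2 m, M m & g = 'X_[m]) <->
    (exists2 D, (exists2 m, M m & D = [set l | (0 < m l)%N]) & g = face_mon k D).
  split=> [[m Mm ->]|[_ [m Mm ->] ->]]; last first.
    by exists m; rewrite // mpolyX_squarefree //; apply: M1.
  by exists [set l | (0 < m l)%N]; [exists m | rewrite mpolyX_squarefree //; apply: M1].
rewrite MI; split=> If J idJ GJ; apply: If => // g /eqG; apply: GJ.
Qed.

Section Components.
Variables (I : {mpoly k[n]} -> Prop) (G : {set 'I_n} -> Prop).
Hypothesis IG : squarefree_gens I G.

Let idI : is_ideal I.
Proof.
have [g0 gD gM] := ideal_gen_ideal (fun f => exists2 D, G D & f = face_mon k D).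
split=> [|f g /IG If /IG Ig|a f /IG If]; apply/IG => //; first exact: gD.
exact: gM.
Qed.

(** A generator [face_mon k D] lies outside the prime exactly when [D] misses [C], and then it
    divides the monomial of the complement of [C]. *)
Lemma sub_var_prime C : sub_ideal I (@var_prime k n C) <-> ~ I (face_mon k (~: C)).
Proof.
split=> [le_IC /le_IC/var_prime_face|nI f /IG If]; first by rewrite subxx.
apply: If => [|_ [D GD ->]]; first by have [] := var_prime_prime k C.
apply/var_prime_face/negP => DC; apply/nI/(face_mon_up idI DC)/IG.
by apply: ideal_gen_in; exists D.
Qed.

(** A face of largest dimension in the Stanley-Reisner complex of [I]: maximal in cardinality, not
    merely under inclusion. *)
Definition max_face D :=
  ~ I (face_mon k D) /\ forall E, ~ I (face_mon k E) -> (#|E| <= #|D|)%N.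

Lemma face_var_prime_exists P : is_prime P -> sub_ideal I P ->
  exists C, [/\ forall l, l \in C <-> P 'X_l, sub_ideal (@var_prime k n C) P
              & ~ I (face_mon k (~: C))].
Proof.
move=> prP le_IP; have [idP _ _] := prP.
have [C CP] : exists C : {set 'I_n}, forall l, l \in C <-> P 'X_l.
  (* Membership in [P] is undecided, so [C] is built one variable at a time by classical case
     analysis. *)
  suff [C CP] : exists C : {set 'I_n}, forall l, l \in enum 'I_n -> l \in C <-> P 'X_l.
    by exists C => l; apply: CP; rewrite mem_enum.
  elim: (enum 'I_n) => [|l r [C CP]]; first by exists set0.
  have [Pl|nPl] := classic (P 'X_l); [exists (l |: C) | exists (C :\ l)] => j.
    rewrite !inE; case: eqP => [->//|_] /= jr; exact: CP.
  rewrite !inE; case: eqP => [->|_] //= jr; exact: CP.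
exists C; split=> // [|/le_IP/(prime_prod prP)[l]].
  by apply: var_prime_min => // l /CP.
by rewrite inE => /negP lC /CP.
Qed.

(* Complements of vertex covers are the sets [D] whose monomial is not in [I]. *)
Lemma min_height_componentP P :
  (associated_prime I P /\ exists h, ideal_height I h /\ prime_height P h) <->
  exists2 D, max_face D & eq_ideal P (@var_prime k n (~: D)).
Proof.
split=> [[[prP [f PE]] [h [[[Q [prQ le_IQ htQ]] hmin] htP]]]|].
  have [idP _ _] := prP.
  have le_IP : sub_ideal I P by move=> g Ig; apply/PE; case: idI => _ _; apply.
  have [C [CP le_CP nIC]] := face_var_prime_exists prP le_IP.
  have le_h E hE : ~ I (face_mon k E) -> prime_height (@var_prime k n (~: E)) hE -> (h <= hE)%N.
    move=> nIE; apply: hmin; first exact: var_prime_prime.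
    by apply/sub_var_prime; rewrite setCK.
  (* A face [E] with more elements would give a variable prime over [I] with fewer variables than
     [C], hence of height below that of [P], which is minimal. *)
  exists (~: C).
    split=> // E nIE; have [hE htE] := var_prime_height (~: E).
    have le_CE : (#|C| <= #|~: E|)%N.
      rewrite leqNgt; apply/negP => lt_EC.
      have := var_prime_chain_card (ltnW lt_EC) (proj1 htE); rewrite lt_EC addn1.
      move=> /(has_chain_sub prP le_CP)/has_chain_height/(_ htP)/leq_trans.
      by move=> /(_ _ (le_h E hE nIE htE)); rewrite ltnn.
    by have := cardsC C; have := cardsC E; lia.
  rewrite setCK => g; split; last exact: le_CP.
  (* If [P] were strictly larger than the prime of [C], that prime would contain [I] and have
     smaller height. *)
  move: g; apply: NNPP => nle_PC; have [hC htC] := var_prime_height C.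
  have := has_chain_prime prP le_CP nle_PC (proj1 htC).
  move=> /has_chain_height/(_ htP)/leq_trans.
  by move=> /(_ _ (le_h (~: C) hC nIC _)); rewrite setCK => /(_ htC); rewrite ltnn.
move=> [D [nID Dmax] PD].
have prC := var_prime_prime k (~: D); have [idC _ _] := prC.
have le_IC : sub_ideal I (@var_prime k n (~: D)) by apply/sub_var_prime; rewrite setCK.
split.
  split; first exact: is_prime_eq prC.
  (* The prime is the colon ideal of [I] by this monomial: multiplying it by a variable outside [D]
     gives a larger set, whose monomial is in [I] by maximality. *)
  exists (face_mon k D) => g; split=> [/PD|Ig].
    apply: (var_prime_min (P := fun g => I (face_mon k D * g))); first exact: colon_ideal.
    move=> l; rewrite inE => lD; rewrite mulrC /face_mon -big_setU1 //=.
    apply: NNPP => /Dmax; rewrite cardsU1 lD; lia.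
  apply/PD; case: prC => _ _ /(_ _ _ (le_IC _ Ig))[/var_prime_face|//].
  by rewrite setCK subxx.
have [h htC] := var_prime_height (~: D); exists h; split; last first.
  split; first exact: has_chain_eq (fun f => iff_sym (PD f)) (proj1 htC).
  by move=> h' Q cQ; apply: has_chain_height htC; apply: has_chain_eq PD _; exists Q.
split=> [|Q h' prQ le_IQ htQ]; first by exists (@var_prime k n (~: D)).
have [C [_ le_CQ nIC]] := face_var_prime_exists prQ le_IQ.
have le_DC : (#|~: D| <= #|C|)%N.
  by have := Dmax _ nIC; have := cardsC C; have := cardsC D; lia.
have := has_chain_sub prQ le_CQ (var_prime_chain_card le_DC (proj1 htC)).
by move=> /has_chain_height/(_ htQ); apply: leq_trans; apply: leq_addr.
Qed.

End Components.

End SquarefreeIdeals.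

(** * Orbits *)

Section Fibers.
Variable T : finType.

Definition fiber_counts n (f : 'I_n -> T) : seq nat :=
  [seq #|[pred j | f j == x]| | x <- enum T].

Lemma size_fiber_counts n (f : 'I_n -> T) : size (fiber_counts f) = #|T|.
Proof. by rewrite size_map -cardE. Qed.

Lemma weight_fiber_counts n (f : 'I_n -> T) (w : T -> nat) :
  weight [seq w x | x <- enum T] (fiber_counts f) = \sum_j w (f j).
Proof.
rewrite (partition_big f predT) //=.
rewrite (eq_bigr (fun x => w x * #|[pred j | f j == x]|)) => [|x _].
  rewrite /fiber_counts -big_enum.
  by elim: (enum T) => [|x e IH] /=; rewrite ?big_nil ?big_cons ?IH.
by rewrite mulnC -sum_nat_const; apply: eq_bigr => j /eqP->.
Qed.

Lemma sumn_fiber_counts n (f : 'I_n -> T) : sumn (fiber_counts f) = n.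
Proof.
rewrite -[RHS](@card_ord n) -sum1_card -(weight_fiber_counts f (fun=> 1)) /fiber_counts.
by elim: (enum T) => //= x e ->; rewrite mul1n.
Qed.

Lemma seq_with_counts (e : seq T) (d : T -> nat) : uniq e ->
  exists r : seq T, [/\ size r = sumn [seq d x | x <- e], {subset r <= e} &
                        {in e, forall x, count_mem x r = d x}].
Proof.
elim: e => [_|x e IH /= /andP[xe /IH[r [sr re rd]]]]; first by exists [::].
exists (nseq (d x) x ++ r); split=> [|y|y].
- by rewrite size_cat size_nseq sr.
- by rewrite mem_cat mem_nseq inE => /orP[/andP[_ ->]//|/re->]; rewrite orbT.
rewrite inE count_cat count_nseq => /predU1P[->|ye] /=.
  by rewrite eqxx mul1n (count_memPn _) ?addn0 //; apply: contra xe => /re.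
by rewrite rd // (negbTE (_ : x != y)) //; apply: contraNneq xe => ->.
Qed.

Lemma fiber_countsP m n (f : 'I_m -> T) (g : 'I_n -> T) :
  vle (fiber_counts f) (fiber_counts g) <->
  (forall x, #|[pred j | f j == x]| <= #|[pred j | g j == x]|).
Proof.
have -> : vle (fiber_counts f) (fiber_counts g) =
    all (fun x => #|[pred j | f j == x]| <= #|[pred j | g j == x]|) (enum T).
  by rewrite /fiber_counts; elim: (enum T) => //= x e <-.
by split=> [/allP le x|le]; [apply: le; rewrite mem_enum | apply/allP].
Qed.

Lemma eq_fiber_counts n (f g : 'I_n -> T) :
  (forall x, #|[pred j | f j == x]| = #|[pred j | g j == x]|) ->
  exists s : 'S_n, forall i, f i = g (s i).
Proof.
move=> eq_fg; apply: perm_eq_reindex; apply/allP => x _ /=.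
by apply/eqP; rewrite !count_mktuple.
Qed.

Lemma fiber_counts_perm n (s : 'S_n) (f g : 'I_n -> T) :
  (forall i, f i = g (s i)) -> fiber_counts f = fiber_counts g.
Proof.
move=> fg; apply: eq_map => x; rewrite -!sum1_card [RHS](reindex_inj (@perm_inj _ s)).
by apply: eq_bigl => i; rewrite !inE fg.
Qed.

Lemma fiber_counts_inj n (f g : 'I_n -> T) :
  fiber_counts f = fiber_counts g -> exists s : 'S_n, forall i, f i = g (s i).
Proof.
move=> eq_fg; apply: eq_fiber_counts => x; apply/eqP; rewrite eqn_leq.
by apply/andP; split; move: x; apply/fiber_countsP; rewrite eq_fg vle_refl.
Qed.

Lemma fiber_counts_onto (d : seq nat) : size d = #|T| ->
  exists f : 'I_(sumn d) -> T, fiber_counts f = d.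
Proof.
move=> sd.
have [r [sr _ rd]] := seq_with_counts (fun x => nth 0 d (index x (enum T))) (enum_uniq T).
have Dd : [seq nth 0 d (index x (enum T)) | x <- enum T] = d.
  apply: (@eq_from_nth _ 0) => [|i]; rewrite size_map -cardE ?sd // => lt_i.
  have [S0 _] : exists S0 : T, S0 \in T by apply/card_gt0P; apply: leq_trans lt_i.
  by rewrite (nth_map S0) -?cardE // index_uniq ?enum_uniq // -cardE.
rewrite Dd in sr; have sr' : size r == sumn d by apply/eqP.
exists (tnth (Tuple sr')); rewrite -[RHS]Dd; apply: eq_map => x.
by rewrite -count_mktuple -rd ?mem_enum //= map_tnth_enum.
Qed.

(** Padding [f] with the values it lacks gives a list with the same multiplicities as [g], hence a
    rearrangement of [g]. *)
Lemma fiber_counts_embed m n (f : 'I_m -> T) (g : 'I_n -> T) :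
  vle (fiber_counts f) (fiber_counts g) ->
  exists (le_mn : m <= n) (s : 'S_n), forall i, f i = g (s (widen_ord le_mn i)).
Proof.
move=> /fiber_countsP le_fg.
have [r [sr _ rd]] := seq_with_counts
  (fun x => #|[pred j | g j == x]| - #|[pred j | f j == x]|) (enum_uniq T).
have Dn : size (mktuple f ++ r) = n.
  rewrite size_cat size_tuple sr -[in RHS](sumn_fiber_counts g) -{1}(sumn_fiber_counts f).
  rewrite /fiber_counts; elim: (enum T) => //= x e <-.
  by rewrite addnACA subnKC.
have le_mn : m <= n by rewrite -Dn size_cat size_tuple leq_addr.
exists le_mn; have /eqP sfr := Dn.
have [|s sP] := @eq_fiber_counts _ (tnth (Tuple sfr)) g.
  move=> x; rewrite -count_mktuple /= map_tnth_enum count_cat rd ?mem_enum //.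
  by rewrite count_mktuple subnKC.
exists s => i; rewrite -sP (tnth_nth (f i)) /= nth_cat size_map size_enum_ord ltn_ord.
by rewrite (nth_map i) ?size_enum_ord // nth_ord_enum.
Qed.

End Fibers.

(** * Columns of monomials and the action of Sym(n) *)

Section Columns.
Local Open Scope ring_scope.
Variables (c : nat) (k : fieldType).

Definition var_row n (l : 'I_(c * n)) : 'I_c :=
  (enum_val (cast_ord (esym (mxvec_cast c n)) l)).1.
Definition var_col n (l : 'I_(c * n)) : 'I_n :=
  (enum_val (cast_ord (esym (mxvec_cast c n)) l)).2.

Lemma var_rowE n (i : 'I_c) (j : 'I_n) : var_row (mxvec_index i j) = i.
Proof. by rewrite /var_row /mxvec_index cast_ordK enum_rankK. Qed.

Lemma var_colE n (i : 'I_c) (j : 'I_n) : var_col (mxvec_index i j) = j.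
Proof. by rewrite /var_col /mxvec_index cast_ordK enum_rankK. Qed.

Definition columns n (D : {set 'I_(c * n)}) (j : 'I_n) : {set 'I_c} :=
  [set i | mxvec_index i j \in D].

Definition of_columns n (F : 'I_n -> {set 'I_c}) : {set 'I_(c * n)} :=
  [set l | var_row l \in F (var_col l)].

Definition relabel_var m n (g : 'I_m -> 'I_n) (l : 'I_(c * m)) : 'I_(c * n) :=
  mxvec_index (var_row l) (g (var_col l)).

Lemma mem_of_columns n (F : 'I_n -> {set 'I_c}) i j :
  (mxvec_index i j \in of_columns F) = (i \in F j).
Proof. by rewrite inE var_rowE var_colE. Qed.

Lemma columnsK n (D : {set 'I_(c * n)}) : of_columns (columns D) = D.
Proof. by apply/setP; case/mxvec_indexP => i j; rewrite mem_of_columns inE. Qed.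

Lemma card_of_columns n (F : 'I_n -> {set 'I_c}) :
  #|of_columns F| = (\sum_j #|F j|)%N.
Proof.
rewrite -sum1_card (partition_big (@var_col n) predT) //=; apply: eq_bigr => j _.
rewrite -sum1_card (reindex_onto (fun i => mxvec_index i j) (@var_row n)) /=.
  by apply: eq_bigl => i; rewrite mem_of_columns var_rowE var_colE !eqxx !andbT.
by case/mxvec_indexP => i j'; rewrite var_rowE var_colE => /andP[_ /eqP->].
Qed.

Lemma relabel_varE m n (g : 'I_m -> 'I_n) i j :
  relabel_var g (mxvec_index i j) = mxvec_index i (g j).
Proof. by rewrite /relabel_var var_rowE var_colE. Qed.

Lemma relabel_var_inj m n (g : 'I_m -> 'I_n) : injective g -> injective (relabel_var g).
Proof.
move=> g_inj; case/mxvec_indexP => i j; case/mxvec_indexP => i' j'.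
rewrite !relabel_varE => eq_ij.
have := congr1 (@var_row n) eq_ij; have := congr1 (@var_col n) eq_ij.
by rewrite !var_rowE !var_colE => /g_inj-> ->.
Qed.

Lemma relabel_varK m n (g : 'I_m -> 'I_n) h :
  cancel g h -> cancel (relabel_var g) (relabel_var h).
Proof. by move=> gK; case/mxvec_indexP => i j; rewrite !relabel_varE gK. Qed.

Lemma relabel_rename m n (g : 'I_m -> 'I_n) (f : polyR c k m) :
  relabel g f = rename (relabel_var g) f.
Proof.
rewrite /relabel /rename; congr (_ \mPo _); apply: eq_from_tnth.
by case/mxvec_indexP => i j; rewrite !tnth_mktuple mxvecE mxE relabel_varE.
Qed.

Lemma rename_face_mon m n (g : 'I_m -> 'I_n) D :
  injective g -> rename g (face_mon k D) = face_mon k (g @: D).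
Proof.
move=> g_inj; rewrite /face_mon rmorph_prod big_imset => [|i j _ _ /g_inj //].
by apply: eq_bigr => l _; apply: renameX.
Qed.

(** A variable prime is determined by the variables it contains, and a permutation moves these
    column by column. *)
Lemma same_orbit_of_columns n (F F' : 'I_n -> {set 'I_c}) :
  same_orbit (@var_prime k _ (~: of_columns F)) (@var_prime k _ (~: of_columns F')) <->
  exists s : 'S_n, forall j, F j = F' (s j).
Proof.
split=> [[s sP]|[s FF']]; exists s.
  have sK := renameK (k := k) (relabel_varK (permK s)).
  move=> j; apply/setP => i; apply/negb_inj.
  rewrite -!mem_of_columns -!in_setC; apply/idP/idP => [/(var_primeX k)|/(var_primeX k)/sP].
    move=> Fij; apply/(var_primeX k)/sP; exists 'X_(mxvec_index i j) => //.
    by rewrite /sym_act relabel_rename renameX relabel_varE.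
  move=> [f f0 Df]; apply/(var_primeX k); congr (var_prime _ _): f0.
  by apply: (can_inj sK); rewrite renameX relabel_varE Df /sym_act relabel_rename.
have CD l : (l \in ~: of_columns F) = (relabel_var s l \in ~: of_columns F').
  by case/mxvec_indexP: l => i j; rewrite relabel_varE !in_setC !mem_of_columns FF'.
have sP := var_prime_rename _ (relabel_varK (permK s)) CD.
move=> f; split=> [f0|[g g0 ->]]; last by rewrite /sym_act relabel_rename; apply/sP.
exists (rename (relabel_var s^-1%g) f).
  by apply/sP; rewrite (renameK (k := k) (relabel_varK (permKV s))).
by rewrite /sym_act relabel_rename (renameK (k := k) (relabel_varK (permKV s))).
Qed.

Variable I : forall n : nat, polyR c k n -> Prop.
Hypothesis hI : Sym_invariant_chain I.

(** Inclusion followed by a suitable permutation places the columns of [F] on equal columns of [F'],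
    so the image of the first monomial divides the second. With equal counts this makes membership
    in [I n] depend on the count vector alone. *)
Lemma face_transfer m n (F : 'I_m -> {set 'I_c}) (F' : 'I_n -> {set 'I_c}) :
  (0 < m)%N -> vle (fiber_counts F) (fiber_counts F') ->
  I (face_mon k (of_columns F)) -> I (face_mon k (of_columns F')).
Proof.
move=> m_gt0 /fiber_countsP/fiber_countsP/fiber_counts_embed[le_mn [s FF']] IF.
have [idI symI] := hI.
have := symI _ _ le_mn s _ m_gt0 IF.
rewrite /sym_act /incl !relabel_rename rename_comp rename_face_mon; last first.
  apply: inj_comp; apply: relabel_var_inj; first exact: perm_inj.
  by move=> i j /(congr1 val) eq_ij; apply: val_inj.
apply: face_mon_up; first exact/idI/(leq_trans m_gt0).
apply/subsetP => _ /imsetP[l lF ->]; move: l lF.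
by case/mxvec_indexP => i j; rewrite /= !relabel_varE !mem_of_columns FF'.
Qed.

End Columns.

Local Open Scope ring_scope.

Theorem corollary8p10 (c : nat) (hc : (0 < c)%N) (k : fieldType)
    (I : forall n : nat, polyR c k n -> Prop)
    (hI : Sym_invariant_chain I)
    (hsf : forall n : nat, (0 < n)%N -> squarefree_monomial_ideal (I n)) :
  exists (p : {poly rat}) (N : nat),
    forall n : nat, (N <= n)%N ->
      exists r : nat, num_min_height_orbits (I n) r /\ r%:R = p.[n%:R].
Proof.
pose T := {set 'I_c}.
(* [U] is an upset: adding a column (possibly empty) to a monomial of [I n] gives a monomial of
   [I n.+1]; so a stabilisation index of the chain is not needed. *)
pose U d := exists n (F : 'I_n -> T),
  [/\ (0 < n)%N, fiber_counts F = d & I n (face_mon k (of_columns F))].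
have UP n (F : 'I_n -> T) : (0 < n)%N -> U (fiber_counts F) <-> I n (face_mon k (of_columns F)).
  move=> n_gt0; split=> [[m [F' [m_gt0 eqF IF']]]|IF]; last by exists n, F.
  by apply: face_transfer IF' => //; rewrite eqF vle_refl.
have uU : upset U.
  move=> a d le_d [m [F [m_gt0 Da IF]]]; rewrite -{}Da in le_d.
  have sd : size d = #|T|.
    by rewrite -(size_fiber_counts F); move: le_d; rewrite /vle all2E => /andP[/eqP->].
  have [F' F'd] := fiber_counts_onto sd; move: le_d; rewrite -F'd => le_d.
  have [le_mn _] := fiber_counts_embed le_d.
  by apply/UP; [apply: leq_trans le_mn | apply: face_transfer IF].
pose ws := [seq #|A| | A : T <- enum T].
have [|B [BU [q [N qP]]]] := @ev_poly_max_weight_count #|T| ws U _ uU.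
  by rewrite size_map -cardE.
(* Passing from [N] to [N.+1] excludes n = 0, where the chain is unconstrained. *)
exists q, N.+1 => n lt_Nn; have n_gt0 : (0 < n)%N by apply: leq_trans lt_Nn.
(* Each orbit corresponds to one count vector in [L], so the number of orbits is its size. *)
pose L := filter (max_weight_in B ws (comps #|T| n)) (comps #|T| n).
exists (size L); split; last by rewrite size_filter; apply: qP; apply: ltnW.
have [G IG] := squarefree_gensP (hsf n n_gt0).
have idI : is_ideal (I n) by case: hI => idI _; apply: idI.
have compsF (F : 'I_n -> T) : fiber_counts F \in comps #|T| n.
  by rewrite mem_comps size_fiber_counts sumn_fiber_counts !eqxx.
have wF (F : 'I_n -> T) : weight ws (fiber_counts F) = #|of_columns F|.
  by rewrite card_of_columns -(weight_fiber_counts F (fun A : T => #|A|)).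
have BF (F : 'I_n -> T) : B (fiber_counts F) <-> ~ I n (face_mon k (of_columns F)).
  by rewrite BU ?size_fiber_counts // UP.
have LF (F : 'I_n -> T) : fiber_counts F \in L <-> max_face (I n) (of_columns F).
  rewrite mem_filter compsF andbT /max_weight_in; split=> [/andP[/BF nIF /allP Fmax]|[/BF-> Fmax]].
    split=> // E; rewrite -(columnsK E) => /BF BE; rewrite -!wF.
    by have := Fmax _ (compsF (columns E)); rewrite BE.
  apply/allP => e; rewrite mem_comps => /andP[/eqP se /eqP sn]; apply/implyP => Be.
  have [E eE] : exists E : 'I_n -> T, fiber_counts E = e.
    by have := fiber_counts_onto se; rewrite sn.
  by rewrite -eE in Be *; rewrite !wF; apply/Fmax/BF.
have /fin_all_exists[F FL] (a : 'I_(size L)) :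
    exists f : 'I_n -> T, fiber_counts f = nth [::] L a.
  have := mem_nth [::] (ltn_ord a); rewrite mem_filter => /andP[_].
  rewrite mem_comps => /andP[/eqP sd /eqP sn].
  by have := fiber_counts_onto sd; rewrite sn.
exists (fun a => @var_prime k _ (~: of_columns (F a))); split=> [a|a b|Q].
- apply/(min_height_componentP IG); exists (of_columns (F a)) => //.
  by apply/LF; rewrite FL mem_nth.
- move=> /same_orbit_of_columns[s Fab]; apply/val_inj/eqP.
  rewrite -(nth_uniq [::] (ltn_ord a) (ltn_ord b)) ?filter_uniq ?comps_uniq // -!FL.
  exact/eqP/fiber_counts_perm/Fab.
move=> /(min_height_componentP IG)[D maxD QD].
move: maxD QD; rewrite -(columnsK D) => /LF DL QD.
have lt_a : (index (fiber_counts (columns D)) L < size L)%N by rewrite index_mem.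
exists (Ordinal lt_a).
have [|s sP] := @fiber_counts_inj _ _ (F (Ordinal lt_a)) (columns D).
  by rewrite FL /= nth_index.
have [|s' s'P] := proj2 (same_orbit_of_columns k (F (Ordinal lt_a)) (columns D)); first by exists s.
by exists s' => f; rewrite QD; apply: s'P.
Qed.
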